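(* Let $r\geq 5$ and let $H$ be an $r$-vertex $r$-color-critical multigraph with $h$ edges. If $k$ is an integer with $$k>\max\left\{\frac{r-1}{r-2}(h-1),\ 2\frac{r-1}{r}\left(h-\frac{r(r-2)}{4}+1\right)\right\}$$ and $n$ is sufficiently large, then $\mathrm{ex}_k(n,H)=k\cdot t_{r-1}(n)$, and the unique $n$-vertex $k$-color extremal multigraph of $H$ is $k\cdot T_{r-1}(n)$ (all $k$ colors are identical copies of $T_{r-1}(n)$).
   Context: A multigraph is loopless with possibly parallel edges; $w_G(uv)$ is the multiplicity of $uv$ and $e(G)$ counts edges with multiplicity. The underlying graph of a multigraph has an edge $uv$ iff $w(uv)\ge 1$; the chromatic number of a multigraph is that of its underlying graph. A multigraph $H$ is $r$-color-critical if it has chromatic number $r$ and it has an edge (a single edge of the multiset) whose removal decreases the chromatic number. A simple $k$-coloring of a multigraph $G$ is a decomposition of its edge multiset as a disjoint sum of $k$ simple graphs $G_1,\dots,G_k$ on $V(G)$ (colors). A copy of the multigraph $H$ in $G$ is multicolored if its edges (counted with multiplicity) receive pairwise distinct colors, i.e. there is an injection $\varphi:V(H)\to V(G)$ and an assignment of pairwise distinct colors to all edges of $H$ such that each copy of $uv$ receives a color $i$ with $\varphi(u)\varphi(v)\in E(G_i)$. $\mathrm{ex}_k(n,H)$ is the maximum number of edges of an $n$-vertex multigraph having a simple $k$-coloring with no multicolored copy of $H$; such maximizers are $k$-color extremal multigraphs. $T_{r-1}(n)$ is the balanced complete $(r-1)$-partite graph on $n$ vertices, $t_{r-1}(n)$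 its number of edges, and $k\cdot T_{r-1}(n)$ the simply $k$-colored multigraph whose $k$ colors are all the same copy of $T_{r-1}(n)$. *)

(* Defs.v *)
From HB Require Import structures.
From mathcomp Require Import all_boot.

Set Implicit Arguments.
Unset Strict Implicit.
Unset Printing Implicit Defensive.

(* An edge uv is the two-element set [set u; v]. *)

Record sgraph (T : finType) := SGraph {
  edges :> {set {set T}};
  edges_loopless : [forall e in edges, #|e| == 2] }.

HB.instance Definition _ (T : finType) := [isSub for @edges T].
HB.instance Definition _ (T : finType) := [Countable of sgraph T by <:].
HB.instance Definition _ (T : finType) := [Finite of sgraph T by <:].

(* [mult G [set u; v]] is the multiplicity w_G(uv). *)
Record mgraph (T : finType) := MGraph {
  mult : {ffun {set T} -> nat};
  mult_loopless : [forall e : {set T}, (#|e| != 2) ==> (mult e == 0)] }.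

HB.instance Definition _ (T : finType) := [isSub for @mult T].
HB.instance Definition _ (T : finType) := [Equality of mgraph T by <:].

Definition nb_edges (T : finType) (G : mgraph T) : nat :=
  \sum_(e : {set T}) mult G e.

Lemma underlying_subproof (T : finType) (G : mgraph T) :
  [forall e in [set e | 0 < mult G e], #|e| == 2].
Proof.
apply/'forall_implyP => e; rewrite inE; apply: contraLR => e2.
by have /forallP/(_ e) := mult_loopless G; rewrite e2 => /eqP ->.
Qed.

Definition underlying (T : finType) (G : mgraph T) : sgraph T :=
  SGraph (underlying_subproof G).

Definition colorable (T : finType) (G : sgraph T) (q : nat) : bool :=
  [exists f : {ffun T -> 'I_q},
    [forall u, forall v, ([set u; v] \in edges G) ==> (f u != f v)]].

Lemma colorable_card (T : finType) (G : sgraph T) : exists q, colorable G q.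
Proof.
exists #|T|; apply/existsP; exists [ffun x => enum_rank x].
apply/forallP => u; apply/forallP => v; apply/implyP => uvG.
rewrite !ffunE (inj_eq enum_rank_inj); apply: contraL uvG => /eqP <-.
apply/negP => uG; have /'forall_implyP/(_ _ uG) := edges_loopless G.
by rewrite setUid cards1.
Qed.

Definition chromatic_number (T : finType) (G : mgraph T) : nat :=
  ex_minn (colorable_card (underlying G)).

Lemma del_edge_subproof (T : finType) (G : mgraph T) (e0 : {set T}) :
  [forall e : {set T}, (#|e| != 2) ==> ([ffun e : {set T} => mult G e - (e == e0)] e == 0)].
Proof.
apply/forallP => e; apply/implyP => e2; rewrite ffunE.
by have /forallP/(_ e) := mult_loopless G; rewrite e2 => /eqP ->.
Qed.

(* Only one of the parallel copies of [e0] is removed. *)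
Definition del_edge (T : finType) (G : mgraph T) (e0 : {set T}) : mgraph T :=
  MGraph (del_edge_subproof G e0).

Definition color_critical (T : finType) (r : nat) (H : mgraph T) : Prop :=
  chromatic_number H = r /\
  exists2 e, 0 < mult H e & chromatic_number (del_edge H e) < r.

Definition kgraph (k : nat) (T : finType) := {ffun 'I_k -> sgraph T}.

Lemma color_sum_subproof (k : nat) (T : finType) (c : kgraph k T) :
  [forall e : {set T}, (#|e| != 2) ==>
    ([ffun e : {set T} => \sum_(i < k) (e \in edges (c i) : nat)] e == 0)].
Proof.
apply/forallP => e; apply/implyP => e2; rewrite ffunE big1 // => i _.
apply/eqP; rewrite eqb0; apply: contra e2 => eci.
by have /'forall_implyP/(_ _ eci) := edges_loopless (c i).
Qed.

(* [c] is a simple k-coloring of [G] exactly when [color_sum c = G]. *)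
Definition color_sum (k : nat) (T : finType) (c : kgraph k T) : mgraph T :=
  MGraph (color_sum_subproof c).

(* The edges of [H] as a multiset: [Tagged _ j] with tag [e] is the j-th of the
   [mult H e] parallel copies of [e]. *)
Definition edge_copy (V : finType) (H : mgraph V) : finType :=
  {e : {set V} & 'I_(mult H e)}.

Definition has_multicolored (k : nat) (T V : finType) (H : mgraph V)
    (c : kgraph k T) : bool :=
  [exists phi : {ffun V -> T}, exists col : {ffun edge_copy H -> 'I_k},
    [&& injectiveb phi, injectiveb col &
        [forall x : edge_copy H, phi @: tag x \in edges (c (col x))]]].

(* The multigraphs having a suitable simple k-coloring are the sums of the
   suitable colorings, so the maximum is taken over the latter (finite) type. *)
Definition ex (k n : nat) (V : finType) (H : mgraph V) : nat :=
  \max_(c : kgraph k 'I_n | ~~ has_multicolored H c) nb_edges (color_sum c).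

Definition admissible (k n : nat) (V : finType) (H : mgraph V)
    (G : mgraph 'I_n) : Prop :=
  exists2 c : kgraph k 'I_n, color_sum c = G & ~~ has_multicolored H c.

Definition extremal (k n : nat) (V : finType) (H : mgraph V)
    (G : mgraph 'I_n) : Prop :=
  admissible k H G /\ nb_edges G = ex k n H.

Definition mgraph_iso (S T : finType) (G : mgraph S) (G' : mgraph T) : Prop :=
  exists2 s : S -> T, bijective s & forall e : {set S}, mult G' (s @: e) = mult G e.

Definition sgraph_iso_by (S T : finType) (s : S -> T) (G : sgraph S)
    (G' : sgraph T) : Prop :=
  bijective s /\ forall e : {set S}, (s @: e \in edges G') = (e \in edges G).

Lemma turan_subproof (q n : nat) :
  [forall e in [set [set uv.1; uv.2] | uv : 'I_n * 'I_n &
                 uv.1 != uv.2 %[mod q]], #|e| == 2].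
Proof.
apply/'forall_implyP => e /imsetP [[u v]]; rewrite inE /= => uv ->.
by rewrite cards2 (contraNneq _ uv) // => ->.
Qed.

(* The parts are the residue classes modulo [q], whose sizes differ by at most
   one. *)
Definition turan (q n : nat) : sgraph 'I_n := SGraph (turan_subproof q n).

Definition turan_number (q n : nat) : nat := #|edges (turan q n)|.

Definition kturan (k q n : nat) : kgraph k 'I_n := [ffun=> turan q n].

(* Main.v *)
(* Replacing a vertex by a clone of another one creates no multicolored [H],
   because the underlying graph of [H] is [K_r]. Hence in an extremal coloring the total degrees differ by at most [k], and
   having no common edge is an equivalence relation. Let [q = r - 1]. A [q]-set
   of maximal total weight is, by exchange, a clique all of whose vertices have
   small deficit. Either every vertex is non-adjacent to some vertex of it, so
   that there are [q] classes and the extremal coloring is the Turan one by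
   convexity; or, for large [n], some further vertex has total deficit at most
   [k] to a suitable such clique. In the latter case [H] is embedded on these
   [r] vertices: its simple edge goes to the lightest pair at the new vertex, and
   the few other light pairs form a matching plus at most one pair, which an
   averaging argument over the placements makes cheap; colors are then chosen
   greedily, lightest pairs first. *)
Require Import Defs.
From mathcomp Require Import all_boot all_order all_algebra all_fingroup zify ring lra.
Import Order.TTheory GRing.Theory Num.Theory.
Set Implicit Arguments.
Unset Strict Implicit.
Unset Printing Implicit Defensive.

(** The greedy choice of colors only asks that, for every c, the pairs of weight at most c carry at
    most c copies of H. With s = h - 'C(r, 2), the first bound on k reads h - 1 < (q - 1)k/q, where
    (q - 1)k/q is the weight of the clique pairs when all have the same, largest allowed deficit.
    The second reads s + (q + 1)^2/4 + 1 < (q + 1)k/(2q), where (q + 1)k/(2q) is the weight below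
    which two clique pairs cannot meet. From this weight on, counting light pairs by their total
    deficit works for every placement of H. Below it the light pairs are few, but all s excess
    copies of H could sit on them, so a placement has to be found. The other obstacle is the r-th
    vertex: the vertices joined to a whole clique may be boundedly many, which averaging over all
    vertices does not see. Hence clique and vertex are chosen together, by a second minimization. *)

(** * Sums over pairs *)

Lemma card2_other (T : finType) (e : {set T}) (x : T) :
  #|e| = 2 -> x \in e -> exists2 u, u != x & e = [set x; u].
Proof.
move=> e2 xe; have /cards1P[u eu] : #|e :\ x| == 1.
  by move/eqP: e2; rewrite (cardsD1 x) xe.
exists u; last by rewrite -(setD1K xe) eu.
by have : u \in e :\ x by [rewrite eu set11]; rewrite !inE => /andP[].
Qed.

Lemma sum_star (T : finType) (F : {set T} -> nat) (x : T) :
  (forall e : {set T}, #|e| != 2 -> F e = 0) ->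
  \sum_y F [set x; y] = \sum_(e : {set T} | x \in e) F e.
Proof.
move=> F0; rewrite (bigID (fun y => y == x)) /= big_pred1_eq setUid F0 ?cards1 //.
rewrite add0n [RHS](bigID (fun e : {set T} => #|e| == 2)) /=.
rewrite [X in _ = _ + X]big1 ?addn0; last by move=> e /andP[_] /F0.
rewrite (partition_big (fun y => [set x; y])
  (fun e : {set T} => (x \in e) && (#|e| == 2))) /=; last first.
  by move=> y yx; rewrite !inE eqxx cards2 eq_sym yx.
apply: eq_bigr => e /andP[xe /eqP e2]; have [z zx e_xz] := card2_other e2 xe.
rewrite (big_pred1 z) ?e_xz //.
move=> y /=; rewrite -e_xz; apply/andP/eqP => [[yx /eqP eyz] | -> //].
  have: y \in e by rewrite -eyz !inE eqxx orbT.
  by rewrite e_xz !inE (negPf yx) => /eqP.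
by rewrite e_xz eqxx.
Qed.

Lemma sum_pairs (T : finType) (F : {set T} -> nat) :
  (forall e : {set T}, #|e| != 2 -> F e = 0) ->
  \sum_x \sum_y F [set x; y] = 2 * \sum_e F e.
Proof.
move=> F0; under eq_bigr do rewrite sum_star //.
rewrite (exchange_big_dep xpredT) //= big_distrr; apply: eq_bigr => e _ /=.
rewrite sum_nat_const; have [/eqP -> //|/F0 ->] := boolP (#|e| == 2).
by rewrite !muln0.
Qed.

(** * Greedy choice of colors and the arithmetic of light pairs *)

(** Induction on a set A of indices, setting aside the x in A with the longest list. All of A is
    then counted in the hypothesis at x, so [C x] has at least #|A| elements, and the other members
    of A use at most #|A| - 1 of them. Only the sublevel sets of the list size have to be tested,
    not all subsets as in Hall's condition. *)
Lemma distinct_representatives (X K : finType) (C : X -> {set K}) :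
  (forall x, #|[set y | #|C y| <= #|C x|]| <= #|C x|) ->
  exists f : {ffun X -> K}, injectiveb f /\ forall x, f x \in C x.
Proof.
move=> HC; case: (pickP (fun _ : X => true)) => [x0 _ | X0]; last first.
  have K0 (x : X) : K by have := X0 x.
  by exists [ffun x => K0 x]; split=> [|x]; first apply/injectiveP => x; have := X0 x.
have [k0 _] : exists k0, k0 \in C x0.
  apply/set0Pn; rewrite -card_gt0; apply: leq_trans (HC x0).
  by apply/card_gt0P; exists x0; rewrite inE.
suff [f f_inj fC] : exists2 f : {ffun X -> K}, {in [set: X] &, injective f} &
    {in [set: X], forall x, f x \in C x}.
  exists f; split=> [|x]; last by apply: fC.
  by apply/injectiveP => x y; apply: f_inj.
have [n] := ubnP #|[set: X]|; elim: n [set: X] => // n IHn A; rewrite ltnS => leAn.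
have [-> | [y0 Ay0]] := set_0Vmem A.
  by exists [ffun=> k0] => [x y | x]; rewrite inE.
have [x /[!inE] Ax xmax] := @arg_maxnP _ _ [pred y in A] (fun y => #|C y|) Ay0.
have [|f f_inj fC] := IHn (A :\ x).
  by move: leAn; rewrite (cardsD1 x A) Ax.
have [c Cc c_new] : exists2 c, c \in C x & c \notin f @: (A :\ x).
  apply/subsetPn/negP => /subset_leq_card; apply/negP; rewrite -ltnNge.
  apply: leq_ltn_trans (leq_imset_card _ _) _; apply: leq_trans (HC x).
  rewrite [X in _ < X](cardsD1 x) inE leqnn ltnS; apply/subset_leq_card.
  by apply/subsetP => y; rewrite !inE => /andP[-> /xmax].
exists [ffun y => if y == x then c else f y] => [y z | y].
  rewrite !ffunE => Ay Az; case: eqVneq => [->|yx]; case: eqVneq => [->|zx] // E.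
  - by case/negP: c_new; rewrite E imset_f // !inE zx.
  - by case/negP: c_new; rewrite -E imset_f // !inE yx.
  - by apply: f_inj; rewrite // !inE ?yx ?zx.
rewrite ffunE; case: eqVneq => [->//|yx Ay]; apply: fC.
by rewrite !inE yx.
Qed.

(* Here [q = r - 1] and [s] is the excess of the number of edges of [H] over
   'C(r, 2); the two strict bounds are the two conditions on [k] without
   denominators. If [l] pairs have weight at most [c], the copies of [H] on them
   number at most [s + l], since every other pair carries at least one copy. *)
Lemma light_pairs_bound (q k s c D l : nat) :
  4 <= q -> k = c + D ->
  q * (2 * s + q.+1 * q) < 2 * (q.-1 * k) + 2 * q ->
  q * (4 * s + q.+1 * q.+1 + 4) < 2 * (q.+1 * k) ->
  q.+1 * k <= 2 * (q * c) -> 2 * l <= q.+1 * q -> 2 * (l * D) <= q.+1 * k ->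
  s + l <= c.
Proof.
move=> q4 kE cond1 cond2 c_ge l_le lD; rewrite leqNgt; apply/negP => c_lt.
case: q q4 cond1 cond2 c_ge l_le lD => // p q4 /=; rewrite kE {k kE}.
move=> cond1 cond2 c_ge l_le lD.
have qD : c + D < p.+1 * D.
  have: p.+1 * (2 * c + 2) <= p.+1 * (2 * s + p.+2 * p.+1) by rewrite leq_mul2l; lia.
  nia.
have cond1' : (2 * (c + D) + p.+1 * (p.+2 * p.+1) < p.+1 * (2 * D + 2 * l)).
  have: p.+1 * (2 * c + 2) <= p.+1 * (2 * s + 2 * l) by rewrite leq_mul2l; lia.
  nia.
(* Here q is [p.+1] and k is [c + D]. Multiplied by D, [cond1'] combines with [lD] into (q(q + 1) -
   2D)(qD - k) < 0, while [qD] makes the second factor positive. Under the contrary assumption, [e]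
   and [g] are these two factors. *)
have D_gt : p.+2 * p.+1 < 2 * D.
  have: (2 * (c + D) + p.+1 * (p.+2 * p.+1)) * D < p.+1 * (2 * D + 2 * l) * D.
    by rewrite ltn_mul2r cond1' andbT; nia.
  move=> H1.
  have H2 : (2 * (c + D) + p.+1 * (p.+2 * p.+1)) * D < p.+1 * (2 * D * D + p.+2 * (c + D)).
    apply: leq_trans H1 _; rewrite -mulnA leq_mul2l; apply/orP; right; clear -lD; nia.
  rewrite ltnNge; apply/negP => H3.
  have [e De] : exists e, p.+2 * p.+1 = 2 * D + e by exists (p.+2 * p.+1 - 2 * D); lia.
  have [g Ge] : exists g, p.+1 * D = c + D + g by exists (p.+1 * D - (c + D)); lia.
  have F1 : (2 * (c + D) + p.+1 * (p.+2 * p.+1)) * D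
      = 2 * (c + D) * D + (p.+2 * p.+1) * (p.+1 * D) by lia.
  have F2 : p.+1 * (2 * D * D + p.+2 * (c + D))
      = 2 * D * (p.+1 * D) + (p.+2 * p.+1) * (c + D) by lia.
  move: H2; rewrite F1 F2 De Ge; move: (c + D) => k; clear; lia.
have cond2' : 2 * (p * (c + D)) + p.+1 * (p.+2 * p.+2 + 8) < p.+1 * (4 * D + 4 * l).
  have: p.+1 * (4 * c + 4) <= p.+1 * (4 * s + 4 * l) by rewrite leq_mul2l; lia.
  by clear -cond2; lia.
have A1 : (2 * (p * (c + D)) + p.+1 * (p.+2 * p.+2 + 8)) * D
    < p.+1 * (4 * D * D + 2 * p.+2 * (c + D)).
  have: (2 * (p * (c + D)) + p.+1 * (p.+2 * p.+2 + 8)) * D < p.+1 * (4 * D + 4 * l) * D.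
    by rewrite ltn_mul2r cond2' andbT; clear -D_gt; nia.
  move=> H1; apply: leq_trans H1 _; rewrite -mulnA leq_mul2l; apply/orP; right.
  clear -lD; nia.
have C : 2 * p.+1 * D <= p * (c + D) by nia.
(* [e] is the slack in [C]. After [A1] is multiplied by p and pk is replaced by 2qD + e, the terms
   in D^2 cancel; [E1] compares what is left in e, [E2] what is left in D, and both contradict the
   strict inequality. *)
have [e De] : exists e, p * (c + D) = 2 * p.+1 * D + e by exists (p * (c + D) - 2 * p.+1 * D); lia.
set k := c + D in A1 De *.
have A2 : 2 * p * D * (p * k) + p * (p.+1 * (p.+2 * p.+2 + 8)) * D
    < 4 * p * p.+1 * D * D + 2 * p.+1 * p.+2 * (p * k).
  move: A1; rewrite -(@ltn_pmul2l p); last by clear -q4; lia.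
  by clear; lia.
have E1 : 2 * p.+1 * p.+2 * e <= 2 * p * D * e.
  have: p.+1 * p.+2 <= p * D.
    apply: (@leq_trans (2 * D)); first by clear -D_gt; lia.
    by rewrite leq_mul2r; apply/orP; right; clear -q4; lia.
  by rewrite -(leq_pmul2r (isT : 0 < 2)) => /(leq_mul (leqnn e)); clear; lia.
have E2 : 4 * p.+1 * p.+2 * p.+1 * D <= p * (p.+1 * (p.+2 * p.+2 + 8)) * D.
  rewrite leq_mul2r; apply/orP; right.
  have: 4 * p.+2 * p.+1 <= p * (p.+2 * p.+2 + 8) by clear -q4; nia.
  by move=> H; clear -H; nia.
rewrite De {De A1} in A2; clear -A2 E1 E2.
have F1 : 2 * p * D * (2 * p.+1 * D + e) = 4 * p * p.+1 * D * D + 2 * p * D * e by lia.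
have F2 : 2 * p.+1 * p.+2 * (2 * p.+1 * D + e)
  = 4 * p.+1 * p.+2 * p.+1 * D + 2 * p.+1 * p.+2 * e by lia.
rewrite F1 F2 in A2; lia.
Qed.

(** * Averaging over placements *)

(** [P] cuts out permutations acting transitively on [C], so the sum of [mu (s @: f)] over s in [P]
    is the same for all f in [C]: [PM] allows reindexing by a t that moves one f to another.
    Cardinals are cross-multiplied to avoid division. *)
Lemma orbit_average (V : finType) (P : pred {perm V}) (mu : {set V} -> nat)
    (A C : {set {set V}}) :
  (forall s t : {perm V}, P t -> P (t * s)%g = P s) ->
  (forall (t : {perm V}) (e : {set V}), P t -> (t @: e \in C) = (e \in C)) ->
  {in C &, forall e e' : {set V}, exists2 t : {perm V}, P t & t @: e = e'} ->
  A \subset C ->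
  #|C| * (\sum_(s | P s) \sum_(f in A) mu (s @: f))
    = #|A| * (#|P| * \sum_(f in C) mu f).
Proof.
move=> PM PC trC sAC; have [C0 | [e0 Ce0]] := set_0Vmem C.
  by move: sAC; rewrite C0 subset0 => /eqP ->; rewrite cards0.
have orbE f : f \in C ->
    \sum_(s : {perm V} | P s) mu (s @: f) = \sum_(s : {perm V} | P s) mu (s @: e0).
  move=> Cf; have [t Pt <-] := trC _ _ Ce0 Cf.
  rewrite [RHS](reindex_inj (mulgI t)) /=; apply: eq_big => s; first by rewrite PM.
  move=> _; congr mu; rewrite -imset_comp; apply: eq_imset => z.
  by rewrite permM.
have sumE (B : {set {set V}}) : B \subset C ->
    \sum_(s : {perm V} | P s) \sum_(f in B) mu (s @: f)
      = #|B| * \sum_(s : {perm V} | P s) mu (s @: e0).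
  move=> sBC; rewrite exchange_big /= -sum_nat_const.
  by apply: eq_bigr => f Bf; apply: orbE; apply: (subsetP sBC).
have CE : \sum_(s : {perm V} | P s) \sum_(f in C) mu (s @: f)
    = #|P| * \sum_(f in C) mu f.
  rewrite -sum_nat_const; apply: eq_bigr => s Ps.
  rewrite [RHS](reindex_inj (imset_inj (@perm_inj _ s))) /=.
  by apply: eq_bigl => f; rewrite PC.
by rewrite sumE // mulnCA -(sumE _ (subxx C)) CE.
Qed.

(** Two transpositions suffice: the first sends u to u' and v to some w, the second sends w to v'
    and fixes u' because w differs from u'. All points moved avoid x and y. *)
Lemma perm_pair_transitive (V : finType) (x y u v u' v' : V) :
  u != v -> u' != v' -> u \notin [set x; y] -> v \notin [set x; y] ->
  u' \notin [set x; y] -> v' \notin [set x; y] ->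
  exists t : {perm V}, [/\ t x = x, t y = y, t u = u' & t v = v'].
Proof.
move=> uv uv' hu hv hu' hv'; pose w := tperm u u' v.
have fixt a b z : z \in [set x; y] -> a \notin [set x; y] -> b \notin [set x; y] ->
    tperm a b z = z :> V.
  by move=> hz ha hb; rewrite tpermD //; apply: contraTneq hz => <-.
have hw : w \notin [set x; y].
  by rewrite /w; case: tpermP.
have wu' : w != u' by rewrite /w -{2}(tpermL u u') (inj_eq perm_inj) eq_sym.
exists (tperm u u' * tperm w v')%g; rewrite !permM.
have hx : x \in [set x; y] by rewrite !inE eqxx.
have hy : y \in [set x; y] by rewrite !inE eqxx orbT.
split; [by rewrite !fixt | by rewrite !fixt | | by rewrite -/w tpermL].
by rewrite tpermL tpermD // eq_sym.
Qed.

(* A uniform permutation fixing [x] and [y] sends each of the three kinds of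
   pairs (meeting [{x, y}] in [x], in [y], not at all) to a uniform pair of the
   same kind, and [M] contains at most a fraction [2 / #|V|] of each kind. *)
Lemma average_labelling (V : finType) (x y : V) (mu : {set V} -> nat)
    (M : {set {set V}}) :
  5 <= #|V| -> x != y ->
  (forall e, e \in M -> #|e| = 2) -> [set x; y] \notin M ->
  #|[set e in M | x \in e]| <= 1 ->
  trivIset [set e in M | x \notin e] ->
  exists s : {perm V}, [/\ s x = x, s y = y &
    #|V| * \sum_(f in M) mu (s @: f) <= 2 * \sum_(e : {set V} | #|e| == 2) mu e].
Proof.
move=> r5 xy M2 xyM Mx trivM.
pose P (s : {perm V}) := (s x == x) && (s y == y).
have Pfix s : P s -> s x = x /\ s y = y by case/andP=> /eqP-> /eqP->.
have PM s t : P t -> P (t * s)%g = P s.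
  by case/Pfix=> tx ty; rewrite /P !permM tx ty.
have memP (s : {perm V}) (e : {set V}) z : s z = z -> (z \in s @: e) = (z \in e).
  by move=> sz; rewrite -{1}sz mem_imset //; apply: perm_inj.
pose W := ~: [set x; y].
have cardW : #|W| = #|V| - 2 by rewrite cardsCs setCK cards2 xy.
pose X := [set e : {set V} | [&& #|e| == 2, x \in e & y \notin e]].
pose Y := [set e : {set V} | [&& #|e| == 2, x \notin e & y \in e]].
pose Z := [set e : {set V} | [&& #|e| == 2, x \notin e & y \notin e]].
have cardZ : 2 * #|Z| = (#|V| - 2) * (#|V| - 3).
  have -> : Z = [set B : {set V} | B \subset W & #|B| == 2].
    apply/setP=> e; rewrite !inE subsetC subUset !sub1set !inE.
    by rewrite andbC.
  by rewrite cards_draws cardW -mul_bin_diag bin1; congr (_ * _); lia.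
have cardE a b : a != b ->
    #|[set e : {set V} | [&& #|e| == 2, a \in e & b \notin e]]| = #|V| - 2.
  move=> ab; have -> : #|V| - 2 = #|~: [set a; b]| by rewrite cardsCs setCK cards2 ab.
  rewrite -(@card_in_imset _ _ (fun u => [set a; u]) (~: [set a; b])); last first.
    move=> u v; rewrite !inE !negb_or => /andP[ua _] /andP[va _] E.
    have: u \in [set a; v] by rewrite -E !inE eqxx orbT.
    by rewrite !inE (negPf ua) => /eqP.
  apply: eq_card => e; apply/idP/imsetP; rewrite !inE.
    case/and3P=> /eqP e2 ae be; have [u ua eE] := card2_other e2 ae; exists u => //.
    have ue : u \in e by rewrite eE !inE eqxx orbT.
    by rewrite !inE negb_or ua (contraNneq _ be) // => <-.
  case=> u; rewrite !inE !negb_or => /andP[ua ub] ->.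
  by rewrite cards2 !inE eqxx !negb_or (eq_sym a u) ua (eq_sym b a) ab (eq_sym b u) ub.
have cardX : #|X| = #|V| - 2 by apply: cardE.
have cardY : #|Y| = #|V| - 2.
  rewrite -(cardE y x) 1?eq_sym //; apply: eq_card => e; rewrite !inE.
  by rewrite [(x \notin e) && _]andbC.
(* By [orbit_average], the average over [M :&: C] is the fraction #|M :&: C| / #|C| of the sum over
   [C], so only this fraction has to be bounded for each kind. *)
have key (C : {set {set V}}) :
    (forall (t : {perm V}) (e : {set V}), P t -> (t @: e \in C) = (e \in C)) ->
    {in C &, forall e e' : {set V}, exists2 t : {perm V}, P t & t @: e = e'} ->
    #|V| * #|M :&: C| <= 2 * #|C| ->
    #|V| * (\sum_(s | P s) \sum_(f in M :&: C) mu (s @: f))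
      <= 2 * (#|P| * \sum_(f in C) mu f).
  move=> PC trC le_MC; have avg := orbit_average mu PM PC trC (subsetIr M C).
  have [C0 | C_gt0] := posnP #|C|.
    by rewrite (cards0_eq C0) setI0 big1 ?muln0 // => s _; rewrite big_set0.
  rewrite -(leq_pmul2l C_gt0) mulnCA avg mulnA [leqRHS]mulnCA [leqRHS]mulnA.
  by rewrite leq_mul2r le_MC orbT.
have split3 (B : {set {set V}}) (g : {set V} -> nat) :
    (forall e, e \in B -> #|e| = 2) -> [set x; y] \notin B ->
    \sum_(f in B) g f = \sum_(f in B :&: X) g f + \sum_(f in B :&: Y) g f
                       + \sum_(f in B :&: Z) g f.
  move=> B2 xyB; rewrite (bigID (fun e : {set V} => x \in e)) /= -addnA; congr (_ + _).
    apply: eq_bigl => e; rewrite !inE; case: (boolP (e \in B)) => //= eB.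
    rewrite B2 //=; case: (boolP (x \in e)) => //= xe; apply/esym.
    apply: contra xyB => ye; suff -> : [set x; y] = e by [].
    by apply/eqP; rewrite eqEcard cards2 xy B2 // subUset !sub1set xe ye.
  rewrite (bigID (fun e : {set V} => y \in e)) /=; congr (_ + _).
    by apply: eq_bigl => e; rewrite !inE -andbA; case: (boolP (e \in B)) => //= /B2 ->.
  by apply: eq_bigl => e; rewrite !inE -andbA; case: (boolP (e \in B)) => //= /B2 ->.
have card_imP (t : {perm V}) (e : {set V}) : #|t @: e| = #|e|.
  by rewrite card_imset //; apply: perm_inj.
have imset2E (t : {perm V}) a b : t @: [set a; b] = [set t a; t b].
  by rewrite imsetU1 imset_set1.
have tr1 a b : a != b -> [set a; b] = [set x; y] ->
    {in [set e : {set V} | [&& #|e| == 2, a \in e & b \notin e]] &,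
      forall e e' : {set V}, exists2 t : {perm V}, P t & t @: e = e'}.
  move=> ab abxy e e'; rewrite !inE => /and3P[/eqP e2 ae be] /and3P[/eqP e2' ae' be'].
  have [u ua eE] := card2_other e2 ae; have [u' ua' eE'] := card2_other e2' ae'.
  have ub : u != b by apply: contraNneq be => <-; rewrite eE !inE eqxx orbT.
  have ub' : u' != b by apply: contraNneq be' => <-; rewrite eE' !inE eqxx orbT.
  have ta : tperm u u' a = a by rewrite tpermD.
  have tb : tperm u u' b = b by rewrite tpermD.
  exists (tperm u u'); last by rewrite eE eE' imset2E ta tpermL.
  have fixab z : z \in [set a; b] -> tperm u u' z = z.
    by rewrite !inE => /orP[] /eqP ->.
  by rewrite /P !fixab ?eqxx // abxy !inE eqxx ?orbT.
have keyX := key X; have keyY := key Y; have keyZ := key Z.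
(* The [ltac:] arguments prove that permutations fixing x and y preserve each kind. *)
have {}keyX := keyX (fun t e Pt => ltac:(by case/Pfix: Pt => tx ty; rewrite !inE card_imP !memP)).
have {}keyY := keyY (fun t e Pt => ltac:(by case/Pfix: Pt => tx ty; rewrite !inE card_imP !memP)).
have {}keyZ := keyZ (fun t e Pt => ltac:(by case/Pfix: Pt => tx ty; rewrite !inE card_imP !memP)).
have {}keyX := keyX (tr1 _ _ xy (erefl _)).
have YE : Y = [set e : {set V} | [&& #|e| == 2, y \in e & x \notin e]].
  by apply/setP => e; rewrite !inE [(x \notin e) && _]andbC.
have {}keyY := keyY (ltac:(by rewrite YE; apply: tr1; rewrite 1?eq_sym // setUC)).
have cX : #|M :&: X| <= 1.
  apply: leq_trans Mx; apply/subset_leq_card/subsetP=> e.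
  by rewrite !inE => /and4P[-> _ ->].
(* Two such pairs would share y while both avoid x, against [trivM]. *)
have cY : #|M :&: Y| <= 1.
  rewrite leqNgt; apply/negP => /card_gt1P[e [e' [+ + ee']]].
  rewrite !inE => /and4P[eM _ xe ye] /and4P[eM' _ xe' ye'].
  have := trivIsetP trivM e e'; rewrite !inE eM eM' xe xe' => /(_ isT isT ee').
  by move/pred0P/(_ y); rewrite /= ye ye'.
have cZ : 2 * #|M :&: Z| <= #|V| - 2.
  have sub : M :&: Z \subset [set e in M | x \notin e].
    by apply/subsetP => e; rewrite !inE => /and4P[-> _ ->].
  have /eqP := trivIsetS sub trivM; rewrite (eq_bigr (fun=> 2)).
    rewrite sum_nat_const mulnC => ->; rewrite -cardW; apply/subset_leq_card.
    apply/bigcupsP => e; rewrite !inE => /and4P[_ _ xe ye]; apply/subsetP => z ze.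
    by rewrite !inE negb_or !(contraTneq _ ze) // => ->.
  by move=> e; rewrite !inE => /andP[/M2].
have {}keyZ : #|V| * (\sum_(s | P s) \sum_(f in M :&: Z) mu (s @: f))
      <= 2 * (#|P| * \sum_(f in Z) mu f).
  apply: keyZ => [e e'|]; last first.
    rewrite cardZ; move: cZ r5; move: #|M :&: Z| #|V| => m n {}cZ {}r5; clear -cZ r5.
    (* The bound m <= (n - 2)/2 is good enough only from n = 6 on; for n = 5 it has to be rounded
       down to m <= 1. *)
    case: (ltnP n 6) => n6; first by have -> : n = 5 by [lia]; lia.
    have [p E] : exists p, n = p + 6 by [exists (n - 6); lia].
    rewrite E in cZ *.
    have H : (p + 6) * (2 * m) <= (p + 6) * (p + 4).
      by rewrite leq_mul2l; apply/orP; right; lia.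
    have -> : p + 6 - 2 = p + 4 by [lia]; have -> : p + 6 - 3 = p + 3 by lia.
    by move: H; clear; nia.
  rewrite !inE => /and3P[e2 xe ye] /and3P[e2' xe' ye'].
  have /cards2P[u [v [uv eE]]] := e2; have /cards2P[u' [v' [uv' eE']]] := e2'.
  have notxy z f : z \in f -> x \notin f -> y \notin f -> z \notin [set x; y].
    by move=> zf xf yf; rewrite !inE negb_or !(contraTneq _ zf) // => ->.
  have [||||t [tx ty tu tv]] := @perm_pair_transitive V x y u v u' v' uv uv'.
  - by apply: notxy xe ye; rewrite eE !inE eqxx.
  - by apply: notxy xe ye; rewrite eE !inE eqxx orbT.
  - by apply: notxy xe' ye'; rewrite eE' !inE eqxx.
  - by apply: notxy xe' ye'; rewrite eE' !inE eqxx orbT.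
  by exists t; rewrite /P ?tx ?ty ?eqxx // eE eE' imset2E tu tv.
have {}keyX := keyX ltac:(by rewrite cardX; clear -cX r5; nia).
have {}keyY := keyY ltac:(by rewrite cardY; clear -cY r5; nia).
have [s Ps le_s] : exists2 s, P s &
    #|V| * \sum_(f in M) mu (s @: f) <= 2 * \sum_(e : {set V} | #|e| == 2) mu e.
  apply/exists_inP; apply: contraT => /exists_inPn no_s.
  have: \sum_(s | P s) 2 * (\sum_(e : {set V} | #|e| == 2) mu e)
      < \sum_(s | P s) #|V| * \sum_(f in M) mu (s @: f).
    (* A strict comparison of the two sums needs one admissible placement, here the identity. *)
    have P1 : P 1%g by rewrite /P !perm1 !eqxx.
    rewrite (bigD1 1%g) // [ltnRHS](bigD1 1%g) //= -addSn leq_add ?ltnNge ?no_s //.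
    by apply: leq_sum => s /andP[Ps _]; apply: ltnW; rewrite ltnNge no_s.
  rewrite ltnNge -big_distrr /= sum_nat_const => /negP[].
  under eq_bigr do rewrite (split3 M) //.
  rewrite !big_split /= !mulnDr.
  apply: leq_trans (leq_add (leq_add keyX keyY) keyZ) _.
  rewrite -!mulnDr mulnCA leq_mul2l; apply/orP; right; rewrite leq_mul2l; apply/orP; right.
  rewrite [leqRHS](bigD1 [set x; y]) ?cards2 ?xy //=.
  pose B := [set e : {set V} | (#|e| == 2) && (e != [set x; y])].
  rewrite [X in _ <= _ + X](eq_bigl (fun e => e \in B)); last by move=> e; rewrite !inE.
  have B2 e : e \in B -> #|e| = 2 by rewrite inE => /andP[/eqP].
  have xyB : [set x; y] \notin B by rewrite inE eqxx andbF.
  rewrite (split3 B _ B2 xyB).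
  apply: leq_trans (leq_addl _ _).
  apply: leq_add; [apply: leq_add|].
  - rewrite [leqRHS](eq_bigl (mem X)) // => e; rewrite !inE.
    case: (#|e| == 2) => //=; rewrite ?andbF //; apply/andb_idl => /andP[_].
    by apply: contraNneq => ->; rewrite !inE eqxx orbT.
  - rewrite [leqRHS](eq_bigl (mem Y)) // => e; rewrite !inE.
    case: (#|e| == 2) => //=; rewrite ?andbF //; apply/andb_idl => /andP[+ _].
    by apply: contraNneq => ->; rewrite !inE eqxx.
  rewrite [leqRHS](eq_bigl (mem Z)) // => e; rewrite !inE.
  case: (#|e| == 2) => //=; rewrite ?andbF //; apply/andb_idl => /andP[+ _].
  by apply: contraNneq => ->; rewrite !inE eqxx.
by exists s; have [sx sy] := Pfix s Ps.
Qed.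

(** * Placing H on r vertices *)

Lemma two_term_bound (I : finType) (P : pred I) (F : I -> nat) (i j : I) :
  P i -> P j -> i != j -> F i + F j <= \sum_(l | P l) F l.
Proof.
move=> Pi Pj ij; rewrite (bigD1 i) //= leq_add2l (bigD1 j) ?leq_addr //.
by rewrite Pj eq_sym ij.
Qed.

Lemma three_term_bound (I : finType) (P : pred I) (F : I -> nat) (i j l : I) :
  P i -> P j -> P l -> i != j -> i != l -> j != l ->
  F i + F j + F l <= \sum_(a | P a) F a.
Proof.
move=> Pi Pj Pl ij il jl; rewrite (bigD1 i) //= -addnA leq_add2l.
by apply: two_term_bound; rewrite ?Pj ?Pl 1?eq_sym ?ij ?il // eq_sym.
Qed.

(** [w] holds the host weights on the r labels, [m] the multiplicities of H; x is the label of the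
    extra vertex and y that of its lightest partner. After relabelling by t, the pair f receives the
    copies of [t @: f], and the conclusion is the hypothesis of [distinct_representatives]. It is
    checked on four ranges of c = [w e], cut at k/q, k/2 and (q + 1)k/(2q). *)
Lemma light_labelling (V : finType) (x y : V) (m w : {set V} -> nat) (q k s : nat) :
  4 <= q -> #|V| = q.+1 -> x != y ->
  (forall e : {set V}, #|e| = 2 -> 0 < m e) -> m [set x; y] = 1 ->
  2 * (\sum_(e : {set V} | #|e| == 2) m e) = 2 * s + q.+1 * q ->
  q * (2 * s + q.+1 * q) < 2 * (q.-1 * k) + 2 * q ->
  q * (4 * s + q.+1 * q.+1 + 4) < 2 * (q.+1 * k) ->
  (forall e, w e <= k) ->
  (forall v, v != x ->
     q * \sum_(e : {set V} | [&& #|e| == 2, v \in e & x \notin e]) (k - w e)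
       <= q.-1 * k) ->
  \sum_(e : {set V} | (#|e| == 2) && (x \in e)) (k - w e) <= k ->
  (forall e : {set V}, #|e| = 2 -> x \in e -> 0 < w [set x; y] <= w e) ->
  exists2 t : {perm V}, [set t x; t y] = [set x; y] &
    forall e : {set V}, #|e| = 2 ->
      \sum_(f : {set V} | (#|f| == 2) && (w f <= w e)) m (t @: f) <= w e.
Proof.
move=> q4 cardV xy m_gt0 mxy hE cond1 cond2 wk degT degx wx.
pose e0 := [set x; y]; pose mu e := (m e).-1.
have e02 : #|e0| = 2 by rewrite cards2 xy.
have xe0 : x \in e0 by rewrite !inE eqxx.
(* A pair below the threshold (q + 1)k/(2q) has deficit above (q - 1)k/(2q), so two of them at a
   vertex v would violate [degT]: the threshold is what makes [M] a matching. *)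
pose M := [set e : {set V} | [&& #|e| == 2, x \notin e & 2 * (q * w e) < q.+1 * k]].
pose M0 := [set e : {set V} |
  [&& #|e| == 2, x \in e, e != e0 & 2 * (q * w e) < q.+1 * k]].
have k_gt : q.+1 < 2 * k.
  have : q * (q.+1 * q.+1) < 2 * (q.+1 * k) by lia.
  move=> H; rewrite ltnNge; apply/negP => H2; clear -H H2 q4; nia.
have MK (e : {set V}) : e \in M -> k <= q * w e.
  rewrite inE => /and3P[/eqP e2 xe _].
  have /cards2P[u [v [uv eE]]] : #|e| == 2 by rewrite e2.
  have ux : u != x by apply: contraNneq xe => <-; rewrite eE !inE eqxx.
  have := degT u ux; rewrite (bigD1 e) /=; last by rewrite e2 xe eE !inE !eqxx.
  move: (wk e) (\sum_(i | _) _) => wke z; clear -wke q4.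
  case: q q4 => // p _ /=; nia.
have degE v (e : {set V}) : v != x -> v \in e -> e \in M -> q.-1 * k < 2 * (q * (k - w e)).
  rewrite inE => vx ve /and3P[_ _]; move: (wk e); clear -q4.
  case: q q4 => // p _ /=; nia.
have MtI : trivIset M.
  apply/trivIsetP => e e' eM eM' ee'; apply/pred0P => v /=; apply/negP => /andP[ve ve'].
  have vx : v != x.
    by apply: contraTneq eM => vE; rewrite inE -{1}vE ve andbF.
  have := degT v vx; rewrite leqNgt => /negP[].
  have := degE v e vx ve eM; have := degE v e' vx ve' eM'.
  have : (k - w e) + (k - w e')
      <= \sum_(e : {set V} | [&& #|e| == 2, v \in e & x \notin e]) (k - w e).
    move: eM eM'; rewrite !inE => /and3P[e2 xe _] /and3P[e2' xe' _].
    by apply: two_term_bound ee'; rewrite ?e2 ?e2' ?xe ?xe' ?ve ?ve'.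
  by move: (\sum_(i | _) _) (q.-1 * k) (k - w e) (k - w e'); clear; move=> *; nia.
have M2 : 2 * #|M| <= q.
  have /eqP := MtI; rewrite (eq_bigr (fun=> 2)); last first.
    by move=> e; rewrite inE => /and3P[/eqP].
  rewrite sum_nat_const mulnC => ->.
  have -> : q = #|[set~ x]| by rewrite cardsC1 cardV.
  apply/subset_leq_card/bigcupsP => e; rewrite inE => /and3P[_ xe _].
  by apply/subsetP => z ze; rewrite !inE; apply: contraTneq ze => ->.
have M0K e : e \in M0 -> k <= 2 * w e.
  rewrite inE => /and4P[/eqP e2 xe ee0 _]; have /andP[_ we0] := wx e e2 xe; rewrite -/e0 in we0.
  have : (k - w e) + (k - w e0) <= k.
    by apply: leq_trans degx; apply: two_term_bound; rewrite ?e2 ?e02 ?xe ?xe0.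
  lia.
(* By [degx], two such pairs and [e0] would have total weight at least 2k, yet each weighs less than
   (q + 1)k/(2q), and 3(q + 1)k/(2q) is below 2k. *)
have M01 : #|M0| <= 1.
  rewrite leqNgt; apply/negP => /card_gt1P[e [e' [+ + ee']]].
  rewrite !inE => /and4P[/eqP e2 xe ee0 wle] /and4P[/eqP e2' xe' ee0' wle'].
  have /andP[_ we0] := wx e e2 xe; rewrite -/e0 in we0.
  have : (k - w e) + (k - w e') + (k - w e0) <= k.
    by apply: leq_trans degx; apply: three_term_bound => //; rewrite ?e2 ?e2' ?e02 ?xe ?xe' ?xe0.
  move: wle wle' we0 (wk e) (wk e') (wk e0); clear -q4 k_gt.
  move: (w e) (w e') (w e0) => a b c wle wle' ca ak bk ck H.
  have: 3 * k <= k + a + b + c by lia.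
  have: 2 * (q * (2 * k)) <= 2 * (q * (a + b + a)).
    by rewrite !leq_mul2l; apply/orP; right; apply/orP; right; lia.
  by move: q4 wle wle' k_gt; clear; nia.
have xyM : [set x; y] \notin M :|: M0.
  by rewrite !inE !eqxx /= !andbF.
(* The average is taken over the excess [mu] only, whose total is s: the single copy that every pair
   must carry does not depend on the placement. *)
have [t [tx ty avg]] : exists t : {perm V}, [/\ t x = x, t y = y &
    #|V| * \sum_(f in M :|: M0) mu (t @: f)
      <= 2 * \sum_(e : {set V} | #|e| == 2) mu e].
  apply: average_labelling => //; first by rewrite cardV.
  - by move=> e; rewrite !inE => /orP[/and3P[/eqP]|/and4P[/eqP]].
  - apply: leq_trans M01; apply/subset_leq_card/subsetP => e; rewrite !inE.
    by case/andP=> /orP[/and3P[_ /negPf->]|-> //].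
  apply: trivIsetS MtI; apply/subsetP => e; rewrite !inE.
  by case/andP=> /orP[-> //|/and4P[_ ->]].
have t2 (f : {set V}) : #|t @: f| = #|f| by rewrite card_imset //; apply: perm_inj.
have te0 : t @: e0 = e0 by rewrite imsetU1 imset_set1 tx ty.
have card2 : 2 * #|[set e : {set V} | #|e| == 2]| = q.+1 * q.
  have -> : [set e : {set V} | #|e| == 2] = [set B : {set V} | B \subset [set: V] & #|B| == 2].
    by apply/setP => e; rewrite !inE subsetT.
  by rewrite cards_draws cardsT cardV -mul_bin_diag bin1.
have mE (e : {set V}) : #|e| = 2 -> m e = (mu e).+1 by move/m_gt0; rewrite /mu => /prednK.
have muE : \sum_(e : {set V} | #|e| == 2) mu e = s.
  move: hE; rewrite (eq_bigr (fun e => mu e + 1)); last first.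
    by move=> e /eqP e2; rewrite mE // addn1.
  rewrite big_split /= sum1dep_card mulnDr card2; clear; lia.
rewrite muE cardV in avg.
exists t; first by rewrite tx ty.
move=> e e2; set c := w e.
pose L := [set f : {set V} | (#|f| == 2) && (w f <= c)].
rewrite (eq_bigl (mem L)); last by move=> f; rewrite !inE.
have c_gt0 : 0 < c.
  have [xe | xe] := boolP (x \in e); first by have /andP[/leq_trans] := wx e e2 xe; apply.
  have [eM | ] := boolP (e \in M).
    by have := MK e eM; rewrite -/c; clear -k_gt; case: (c) => //; rewrite muln0; lia.
  rewrite inE e2 eqxx xe /= -leqNgt -/c lt0n => H.
  by apply: contraTneq H => ->; rewrite !muln0 -ltnNge muln_gt0 /=; clear -k_gt; lia.
(* One copy for [e0], one compulsory copy for each pair of [B], and at most 2s/(q + 1) excess copies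
   by the choice of t. *)
have bnd (B : {set {set V}}) : B \subset M :|: M0 -> L \subset e0 |: B ->
    q.+1 * (\sum_(f in L) m (t @: f)) <= q.+1 * (#|B|.+1) + 2 * s.
  move=> sB sL; apply: (@leq_trans (q.+1 * (\sum_(f in e0 |: B) m (t @: f)))).
    by rewrite leq_mul2l [leqRHS](big_setID L) /= (setIidPr sL) leq_addr.
  rewrite big_setU1 /=; last by apply: contra xyM => /(subsetP sB).
  rewrite te0 mxy (eq_bigr (fun f : {set V} => mu (t @: f) + 1)); last first.
    move=> f /(subsetP sB); rewrite !inE => fM; rewrite mE ?addn1 // t2.
    by case/orP: fM => [/and3P[/eqP]|/and4P[/eqP]].
  rewrite big_split /= sum1_card addnCA add1n mulnDr addnC leq_add2l.
  apply: leq_trans avg; rewrite leq_mul2l [leqRHS](big_setID B) /= (setIidPr sB).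
  by rewrite leq_addr.
have Lw f : f \in L -> w f <= c by rewrite inE => /andP[].
have LM f : f \in L -> 2 * (q * c) < q.+1 * k -> f \in e0 |: (M :|: M0).
  rewrite !inE => /andP[-> wf] /= cs.
  have -> : 2 * (q * w f) < q.+1 * k.
    by apply: leq_ltn_trans cs; rewrite !leq_mul2l wf !orbT.
  by rewrite -/e0; case: (f == e0) => //=; case: (x \in f).
(* Pairs of [M] weigh at least k/q by [MK], those of [M0] at least k/2 by [M0K]. So below k/q only
   [e0] can be light, and below k/2 only [e0] and the pairs of [M]. *)
have [qc | qc] := ltnP (q * c) k.
  have sL : L \subset [set e0].
    apply/subsetP => f fL; have /LM : f \in L by []; case/(_ _)/setU1P => [|->|].
    - by clear -qc q4; nia.
    - by rewrite set11.
    case/setUP => fM.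
      by have := leq_mul (leqnn q) (Lw f fL); have := MK f fM; clear -qc; lia.
    have wf := Lw f fL; have H := M0K f fM.
    by clear -H wf qc q4; nia.
  apply: (@leq_trans (\sum_(f in [set e0]) m (t @: f))).
    by rewrite [leqRHS](big_setID L) /= (setIidPr sL) leq_addr.
  by rewrite big_set1 te0 mxy.
have [c2 | c2] := ltnP (2 * c) k.
  have sL : L \subset e0 |: M.
    apply/subsetP => f fL; have /LM : f \in L by []; case/(_ _)/setU1P => [|->|].
    - by clear -c2 q4; nia.
    - by rewrite setU11.
    case/setUP => fM; first by rewrite setU1r.
    by have := Lw f fL; have := M0K f fM; clear -c2; lia.
  have := bnd M (subsetUl _ _) sL; move: (\sum_(f in L) _) => S HS.
  rewrite leqNgt; apply/negP => cS.
  have : q.+1 * c.+1 <= q.+1 * #|M|.+1 + 2 * s.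
    by apply: leq_trans HS; rewrite leq_mul2l cS orbT.
  move: M2 cond2 qc; clear -q4; move: #|M| => a; nia.
have [qc2 | qc2] := ltnP (2 * (q * c)) (q.+1 * k).
  have sL : L \subset e0 |: (M :|: M0) by apply/subsetP => f fL; apply: LM.
  have := bnd _ (subxx _) sL; move: (\sum_(f in L) _) => S HS.
  rewrite leqNgt; apply/negP => cS.
  have : q.+1 * c.+1 <= q.+1 * (#|M| + 1).+1 + 2 * s.
    apply: leq_trans (_ : q.+1 * S <= _); first by rewrite leq_mul2l cS orbT.
    apply: leq_trans HS _; rewrite leq_add2r leq_mul2l ltnS.
    by rewrite (leq_trans (leq_card_setU _ _)) ?orbT // leq_add2l.
  move=> H; have {}H : 2 * (q.+1 * c.+1) <= q.+1 * q + 4 * q.+1 + 4 * s.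
    have : q.+1 * (2 * #|M|) <= q.+1 * q by rewrite leq_mul2l M2 orbT.
    by move: H; move: #|M|; clear; move=> *; nia.
  have Hq : q * (2 * (q.+1 * c.+1)) <= q * (q.+1 * q + 4 * q.+1 + 4 * s).
    by rewrite leq_mul2l H orbT.
  have Hc : q.+1 * q * k <= q.+1 * q * (2 * c) by rewrite leq_mul2l c2 orbT.
  move: q4 cond2 k_gt Hq Hc; clear; case: q => // p.
  by do 3!case: p => // p; move=> _ cond2 k_gt Hq Hc; nia.
(* From the threshold on, all s excess copies may lie on [L], and the size of [L] is controlled by
   the total deficit. *)
have eqm f : f \in L -> m (t @: f) = mu (t @: f) + 1.
  by rewrite inE => /andP[/eqP f2 _]; rewrite mE ?t2 // addn1.
rewrite (eq_bigr _ eqm) big_split /= sum1_card.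
apply: (@leq_trans (s + #|L|)).
  rewrite leq_add2r -muE [leqRHS](reindex_inj (imset_inj (@perm_inj _ t))) /=.
  rewrite [leqRHS](eq_bigl (mem [set f : {set V} | #|f| == 2])) => [|f]; last by rewrite !inE t2.
  rewrite [leqRHS](big_setID L) /= (setIidPr _) ?leq_addr //.
  by apply/subsetP => f; rewrite !inE => /andP[].
have lL : 2 * #|L| <= q.+1 * q.
  rewrite -card2 leq_mul2l; apply/orP; right; apply/subset_leq_card/subsetP => f.
  by rewrite !inE => /andP[].
apply: (@light_pairs_bound q k s c (k - c)) => //.
  by rewrite subnKC // /c wk.
(* Summing [degT] over the q vertices other than x counts every pair twice. *)
have sumT : 2 * (\sum_(e : {set V} | (#|e| == 2) && (x \notin e)) (k - w e)) <= q.-1 * k.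
  rewrite -(@leq_pmul2l q) ?(leq_trans _ q4) //.
  have : \sum_(v | v != x)
      q * (\sum_(e : {set V} | [&& #|e| == 2, v \in e & x \notin e]) (k - w e))
      <= \sum_(v | v != x) q.-1 * k by apply: leq_sum.
  rewrite sum_nat_const cardC1 cardV /=; apply: leq_trans.
  rewrite -big_distrr leq_mul2l /=; apply/orP; right.
  rewrite (exchange_big_dep (fun e : {set V} => (#|e| == 2) && (x \notin e))) /=; last first.
    by move=> v f _ /and3P[-> _ ->].
  rewrite big_distrr /=; apply: leq_sum => f /andP[/eqP f2 xf].
  rewrite sum_nat_cond_const leq_mul2r -[leqLHS]f2; apply/orP; right.
  apply/subset_leq_card/subsetP => z zf; rewrite !inE f2 zf xf !andbT.
  by apply: contraTneq zf => ->.
have : #|L| * (k - c) <= \sum_(e : {set V} | #|e| == 2) (k - w e).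
  rewrite -sum_nat_const (bigID (mem L) (fun e : {set V} => #|e| == 2)) /=.
  apply: leq_trans (leq_addr _ _).
  rewrite [leqRHS](eq_bigl (mem L)) => [|f]; last by rewrite !inE andbA andbb.
  by apply: leq_sum => f; rewrite inE => /andP[_ wf]; lia.
rewrite (bigID (fun e : {set V} => x \in e)) /=.
move: sumT degx; clear -q4; case: q q4 => // p _ /=; nia.
Qed.

(** * Deficits: the clique and its extension *)

Section Deficits.

(** [d x y] stands for k minus the multiplicity of xy, so the value k means non-adjacency, [d_diag]
    and [d_trans] make it an equivalence, and [d_deg] says that the deficits at a vertex sum to at
    most k#|T|/q + 2k. *)
Variables (T : finType) (d : T -> T -> nat) (k q : nat).
Hypotheses (d_sym : forall x y, d x y = d y x) (d_le : forall x y, d x y <= k)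
  (d_diag : forall x, d x x = k)
  (d_trans : forall x y z, d x y = k -> d y z = k -> d x z = k)
  (d_deg : forall x, q * (\sum_y d x y) <= k * #|T| + 2 * (k * q))
  (k_gt0 : 0 < k) (q_gt1 : 1 < q).

Local Notation D A x := (\sum_(u in A) d u x).
Local Notation tot A := (\sum_(v in A) D A v).

Lemma total_deficit_setU1 (A : {set T}) x :
  x \notin A -> tot (x |: A) = tot A + 2 * D A x + k.
Proof.
move=> xA; rewrite big_setU1 //= big_setU1 //= d_diag.
have -> : \sum_(v in A) D (x |: A) v = \sum_(v in A) (d x v + D A v).
  by apply: eq_bigr => v _; rewrite big_setU1.
rewrite big_split /=.
have -> : \sum_(v in A) d x v = D A x by apply: eq_bigr => v _; apply: d_sym.
lia.
Qed.

(** Replacing v by any x outside the rest A of [T0] cannot lower the total, so [D A v] is at most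
    the average of [D A x] over these x. By [d_deg] this average exceeds (q - 1)k/q by less than 1/q
    when T is large, and integrality removes the error. *)
Lemma minimal_deficit (T0 : {set T}) :
  q * (q * (4 * (k * q))) < #|T| -> #|T0| = q ->
  (forall A : {set T}, #|A| = q -> tot T0 <= tot A) ->
  forall v, v \in T0 -> q * D (T0 :\ v) v <= q.-1 * k.
Proof.
move=> n_large T0q T0min v vT0; set A := T0 :\ v.
have vA : v \notin A by rewrite !inE eqxx.
have T0E : T0 = v |: A by rewrite setD1K.
have Aq : #|A| = q.-1 by rewrite -T0q (cardsD1 v T0) vT0.
have exch x : x \in ~: A -> D A v <= D A x.
  rewrite inE => xA; have := T0min (x |: A); rewrite cardsU1 xA Aq.
  rewrite T0E !total_deficit_setU1 // => /(_ ltac:(lia)).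
  by rewrite leq_add2r leq_add2l leq_mul2l.
have sumA : q * (\sum_(x in ~: A) D A x) <= q.-1 * (k * #|T| + 2 * (k * q)).
  apply: (@leq_trans (q * \sum_x D A x)).
    by rewrite leq_mul2l [leqRHS](bigID (mem (~: A))) /= leq_addr orbT.
  rewrite exchange_big big_distrr /= -Aq -sum_nat_const.
  by apply: leq_sum => u _; apply: d_deg.
have low : #|~: A| * D A v <= \sum_(x in ~: A) D A x.
  by rewrite -sum_nat_const; apply: leq_sum.
have cardA : #|~: A| + q.-1 = #|T| by rewrite -Aq addnC cardsC.
move: sumA low cardA n_large; move: (D A v) (\sum_(x in ~: A) _) => s S.
move: #|~: A| #|T| => c n; clear -q_gt1 k_gt0 => sumA low cardA n_large.
rewrite leqNgt; apply/negP => Hs.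
have H1 : c * (q.-1 * k).+1 <= c * (q * s) by rewrite leq_mul2l Hs orbT.
have H2 : q * (c * s) <= q * S by rewrite leq_mul2l low orbT.
rewrite -{}cardA in sumA n_large.
case: q q_gt1 sumA n_large H1 H2 {Hs} => // p p1 /= sumA n_large H1 H2.
have : c <= p * (k * p + 2 * (k * p.+1)) by nia.
nia.
Qed.

(** If some minimal clique has a vertex adjacent to all of it, take such a pair ([T0], a) of least
    joint deficit and suppose this exceeds k. The classes [S t] of non-neighbors of the t in [T0]
    then cover all but boundedly many vertices and have about #|T|/q elements each. Almost every x
    in [S t] could replace t, so minimality gives d t a <= d x a. Summing over x bounds #|T| times
    the joint deficit by q times the total deficit of a, up to a constant, hence by k#|T| plus a
    constant: a contradiction for large T. *)
Lemma clique_with_extension :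
  10 * (k ^ 3 * q ^ 3) < #|T| ->
  exists T0 : {set T}, [/\ #|T0| = q,
    forall v, v \in T0 -> q * D (T0 :\ v) v <= q.-1 * k &
    (forall x, exists2 t, t \in T0 & d t x = k) \/
    exists2 a, forall t, t \in T0 -> d t a < k & D T0 a <= k].
Proof.
move=> n_large.
have k_le : k <= k ^ 3 by rewrite -{1}(expn1 k) leq_pexp2l.
have k2_le : k ^ 2 <= k ^ 3 by rewrite leq_pexp2l.
have q_le : q <= q ^ 3 by rewrite -{1}(expn1 q) leq_pexp2l // ltnW.
have q2_le : q ^ 2 <= q ^ 3 by rewrite leq_pexp2l // ltnW.
have n_large' : q * (q * (4 * (k * q))) < #|T|.
  apply: leq_ltn_trans n_large; have := leq_mul k_le (leqnn (q ^ 3)).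
  by rewrite !expnS expn0; clear; lia.
have n_q : q <= #|T|.
  apply: ltnW; apply: leq_ltn_trans n_large'; clear -q_gt1 k_gt0.
  by rewrite -{1}(muln1 q) leq_mul2l !muln_gt0; lia.
have [A0 A0q] : exists A : {set T}, #|A| == q.
  have : 0 < #|[set A : {set T} | A \subset setT & #|A| == q]|.
    by rewrite cards_draws bin_gt0 cardsT.
  by case/card_gt0P => A; rewrite inE => /andP[_ Aq]; exists A.
pose T1 := [arg min_(A < A0 | #|A| == q) tot A].
have [T1q T1min] : #|T1| == q /\ forall A : {set T}, #|A| == q -> tot T1 <= tot A.
  by rewrite /T1; case: arg_minnP.
pose good (p : {set T} * T) :=
  [&& #|p.1| == q, tot p.1 <= tot T1 & [forall t in p.1, d t p.2 < k]].
have good_min p : good p -> #|p.1| = q /\ forall A : {set T}, #|A| = q -> tot p.1 <= tot A.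
  case/and3P=> /eqP pq le_p _; split=> // A /eqP Aq.
  by apply: leq_trans le_p (T1min _ Aq).
have [/existsP[p0 p0good] | /existsPn none] := boolP [exists p, good p]; last first.
  exists T1; split; first exact/eqP.
    by apply: minimal_deficit => //; [apply/eqP | move=> A /eqP; apply: T1min].
  left=> x; have := none (T1, x); rewrite /good T1q leqnn /= => /forall_inPn[t tT1].
  by rewrite -leqNgt => le_k; exists t => //; apply/eqP; rewrite eqn_leq d_le le_k.
pose p1 := [arg min_(p < p0 | good p) D p.1 p.2].
have [p1good p1min] : good p1 /\ forall p, good p -> D p1.1 p1.2 <= D p.1 p.2.
  by rewrite /p1; case: arg_minnP.
case: p1 p1good p1min => T0 a /= Tgood Tmin.
have [/= T0q T0min] := good_min _ Tgood.
have T0deg := minimal_deficit n_large' T0q T0min.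
have aT0 t : t \in T0 -> d t a < k by case/and3P: Tgood => _ _ /forall_inP; apply.
exists T0; split=> //; right; exists a => //; rewrite leqNgt; apply/negP => Da.
pose S t := [set x | d t x == k].
have T0adj t t' : t \in T0 -> t' \in T0 -> t' != t -> d t' t < k.
  move=> tT0 t'T0 tt'; have := T0deg t tT0.
  rewrite (bigD1 t') /=; last by rewrite !inE tt'.
  move: (\sum_(i | _) _) (d t' t) => z y; clear -q_gt1 k_gt0.
  case: q q_gt1 => // p _ /=; nia.
have S1 x t t' : t \in T0 -> t' \in T0 -> x \in S t -> x \in S t' -> t = t'.
  rewrite !inE => tT0 t'T0 /eqP xt /eqP xt'; apply: contraTeq isT => tt'.
  have := T0adj t' t t'T0 tT0 tt'; rewrite d_sym in xt'.
  by rewrite (d_trans xt xt') ltnn.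
pose O := [set x | [forall t in T0, x \notin S t]].
(* A vertex of [O] forms a good pair with [T0], so its deficit is at least that of [a], hence above
   k; any other vertex is non-adjacent to some t. *)
have Dlow x : k + (x \in O) <= D T0 x.
  have [xO | ] := boolP (x \in O).
    rewrite addn1; apply: leq_trans Da _; apply: (Tmin (T0, x)).
    case/and3P: Tgood => /= Tq le_T _; rewrite /good /= Tq le_T /=.
    apply/forall_inP => t tT0; rewrite ltn_neqAle d_le andbT.
    by move: xO; rewrite inE => /forall_inP/(_ t tT0); rewrite inE.
  rewrite inE => /forall_inPn[t tT0]; rewrite negbK inE addn0 => /eqP <-.
  by rewrite [leqRHS](bigD1 t) //= leq_addr.
have sumD : q * (\sum_x D T0 x) <= q * (k * #|T| + 2 * (k * q)).
  rewrite exchange_big big_distrr /= -{2}T0q -sum_nat_const.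
  by apply: leq_sum => u _; apply: d_deg.
have {}sumD : \sum_x D T0 x <= k * #|T| + 2 * (k * q).
  by move: sumD; rewrite leq_pmul2l // ltnW.
have cardO : #|O| <= 2 * (k * q).
  have : \sum_x (k + (x \in O)) <= \sum_x D T0 x by apply: leq_sum.
  rewrite big_split /= sum_nat_const -big_mkcond /= sum1_card mulnC.
  by move/leq_trans/(_ sumD); rewrite leq_add2l.
(* [E] is the part of the deficit towards [T0] that does not come from non-adjacent pairs; it stays
   bounded as T grows. *)
pose E := \sum_(t in T0) \sum_(x | x \notin S t) d t x.
have cardS : #|T| <= \sum_(t in T0) #|S t| + #|O|.
  rewrite -[#|T|]sum1_card -[#|O|]sum1_card.
  have -> : \sum_(t in T0) #|S t| = \sum_(t in T0) \sum_x (x \in S t : nat).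
    by apply: eq_bigr => t _; rewrite -sum1_card big_mkcond.
  rewrite exchange_big [X in _ <= _ + X]big_mkcond -big_split /=.
  apply: leq_sum => x _; case: (boolP (x \in O)) => [_|]; first by rewrite addn1.
  rewrite inE => /forall_inPn[t tT0]; rewrite negbK => xS.
  by rewrite (bigD1 t) //= xS.
have sumDE : \sum_x D T0 x = k * (\sum_(t in T0) #|S t|) + E.
  rewrite exchange_big big_distrr -big_split /=; apply: eq_bigr => t _.
  rewrite (bigID (mem (S t))) /=; congr (_ + _).
  by rewrite mulnC -sum_nat_const; apply: eq_bigr => x; rewrite inE => /eqP.
have E_le : E <= 2 * (k * q) + k * (2 * (k * q)).
  have : k * #|T| <= k * (\sum_(t in T0) #|S t| + 2 * (k * q)).
    by rewrite leq_mul2l (leq_trans cardS) ?orbT // leq_add2l.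
  move: sumD; rewrite sumDE; clear; lia.
(* If x has no deficit towards the rest of [T0], exchanging t for x gives another good pair and
   minimality applies; otherwise the factor k makes the bound trivial. The errors add up to at most
   kE. *)
have step t x : t \in T0 -> x \in S t -> d a t <= d a x + k * D (T0 :\ t) x.
  move=> tT0 xS; have [D0 | Dpos] := posnP (D (T0 :\ t) x); last first.
    by apply: leq_trans (d_le _ _) _; rewrite (leq_trans _ (leq_addl _ _)) // leq_pmulr.
  rewrite D0 muln0 addn0; set A := T0 :\ t.
  have tA : t \notin A by rewrite !inE eqxx.
  have T0E : T0 = t |: A by rewrite setD1K.
  have Aq : #|A| = q.-1 by rewrite -T0q (cardsD1 t T0) tT0.
  have d_tx : d t x = k by move: xS; rewrite inE => /eqP.
  have xA : x \notin A.
    apply/negP => xA; have: D A x = 0 by []; rewrite (bigD1 x) //= d_diag.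
    by case: (k) k_gt0.
  have goodx : good (x |: A, a).
    rewrite /good /= cardsU1 xA Aq; apply/and3P; split; first by clear -q_gt1; lia.
      rewrite total_deficit_setU1 // D0; apply: leq_trans (T0min T1 (eqP T1q)).
      by rewrite T0E total_deficit_setU1 // leq_add2r leq_add2l leq_mul2l leq0n.
    apply/forall_inP => t' /setU1P[->|]; last first.
      by rewrite inE => /andP[_]; apply: aT0.
    rewrite ltn_neqAle d_le andbT; apply: contraTneq (aT0 t tT0) => xa.
    by rewrite (d_trans d_tx xa) ltnn.
  have := Tmin _ goodx; rewrite /= T0E !big_setU1 //= leq_add2r.
  by rewrite (d_sym t) (d_sym x).
have sumS : \sum_(t in T0) #|S t| * d a t <= \sum_x d a x + k * E.
  apply: (@leq_trans (\sum_(t in T0) \sum_(x in S t) (d a x + k * D (T0 :\ t) x))).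
    apply: leq_sum => t tT0; rewrite -sum_nat_const; apply: leq_sum => x.
    exact: step.
  rewrite (exchange_big_dep xpredT) //= /E.
  rewrite [X in _ <= _ + k * X](exchange_big_dep xpredT) //= big_distrr -big_split /=.
  apply: leq_sum => x _.
  have [/existsP[t /andP[tT0 xS]] | /existsPn none] :=
    boolP [exists t, (t \in T0) && (x \in S t)]; last first.
    by rewrite big_pred0 // => t; apply/negbTE/none.
  rewrite (big_pred1 t); last first.
    move=> t' /=; apply/andP/eqP => [[t'T0 xS'] | -> //].
    by apply: S1 xS' xS.
  rewrite leq_add2l leq_mul2l; apply/orP; right.
  rewrite [leqRHS](eq_bigl (mem (T0 :\ t))) // => t'; rewrite !inE andbC.
  case: (boolP (t' \in T0)) => [t'T0|]; last by rewrite !andbF.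
  rewrite !andbT; congr (~~ _); apply/idP/eqP => [xS'|->]; last by move: xS; rewrite inE.
  by apply: S1 xS => //; rewrite inE.
have S_le t : q * #|S t| <= #|T| + 2 * q.
  have : q * (#|S t| * k) <= k * #|T| + 2 * (k * q).
    apply: leq_trans (d_deg t); rewrite leq_mul2l; apply/orP; right.
    rewrite -sum_nat_const [leqRHS](bigID (mem (S t))) /=.
    apply: leq_trans (leq_addr _ _); apply: leq_sum => x; rewrite inE => /eqP ->.
    by [].
  move=> H; rewrite -(leq_pmul2l k_gt0); move: H; clear; lia.
have S_ge t : t \in T0 -> #|T| <= q * #|S t| + 2 * (k * q) * q + 2 * q * q.
  move=> tT0; have : q * #|T| <= q * #|S t| + q.-1 * (#|T| + 2 * q) + 2 * (k * q) * q.
    have H : q * #|T| <= q * (\sum_(t in T0) #|S t|) + 2 * (k * q) * q.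
      rewrite [2 * (k * q) * q]mulnC -mulnDr leq_mul2l (leq_trans cardS) ?orbT //.
      by rewrite leq_add2l.
    apply: leq_trans H _; rewrite leq_add2r (bigD1 t) //= mulnDr leq_add2l.
    rewrite big_distrr /= (_ : q.-1 = #|T0 :\ t|).
      rewrite -sum_nat_const [leqRHS](eq_bigl (fun t' => (t' \in T0) && (t' != t))).
        by apply: leq_sum => t' _; apply: S_le.
      by move=> t'; rewrite !inE andbC.
    by rewrite -T0q (cardsD1 t T0) tT0.
  clear -q_gt1; case: q q_gt1 => // p _ /=; lia.
have Dqk : D T0 a <= q * k.
  by rewrite -T0q -sum_nat_const; apply: leq_sum => t _; apply: d_le.
have : #|T| * D T0 a <= k * #|T| + 2 * (k * q) + q * (k * E)
    + (2 * (k * q) * q + 2 * q * q) * D T0 a.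
  apply: (@leq_trans (\sum_(t in T0) (q * (#|S t| * d a t)
      + (2 * (k * q) * q + 2 * q * q) * d t a))).
    rewrite big_distrr /=; apply: leq_sum => t tT0.
    by rewrite (d_sym a t) mulnA -mulnDl leq_mul2r addnA S_ge ?orbT.
  rewrite big_split /= -!big_distrr /= leq_add2r.
  apply: (@leq_trans (q * (\sum_x d a x + k * E))); first by rewrite leq_mul2l sumS orbT.
  by rewrite mulnDr leq_add2r; apply: d_deg.
rewrite leqNgt => /negP[].
have H1 : #|T| * k.+1 <= #|T| * D T0 a by rewrite leq_mul2l Da orbT.
apply: leq_trans H1; have -> : #|T| * k.+1 = k * #|T| + #|T| by clear; lia.
rewrite -!addnA ltn_add2l.
(* The five error terms 2kq, 2k^2 q^2, 2k^3 q^2, 2k q^3 and 2k^2 q^3 are each at most 2k^3 q^3,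
   whence the constant 10. *)
apply: leq_ltn_trans n_large.
have H2 : q * (k * E) <= q * (k * (2 * (k * q) + k * (2 * (k * q)))).
  by rewrite !leq_mul2l E_le !orbT.
have H3 : (2 * (k * q) * q + 2 * q * q) * D T0 a
    <= (2 * (k * q) * q + 2 * q * q) * (q * k) by rewrite leq_mul2l Dqk orbT.
have L1 := leq_mul k_le q_le; have L2 := leq_mul k2_le q2_le.
have L3 := leq_mul (leqnn (k ^ 3)) q2_le; have L4 := leq_mul k2_le (leqnn (q ^ 3)).
have L5 := leq_mul k_le (leqnn (q ^ 3)).
move: H2 H3 L1 L2 L3 L4 L5; rewrite !expnS !expn0; clear; lia.
Qed.

End Deficits.

(** * Multiplicities, pullbacks and symmetrization by clones *)

Lemma mult_eq0 (T : finType) (G : mgraph T) (e : {set T}) : #|e| != 2 -> mult G e = 0.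
Proof. by move=> e2; have /forallP/(_ e) := mult_loopless G; rewrite e2 => /eqP. Qed.

Lemma edges_card2 (T : finType) (G : sgraph T) (e : {set T}) :
  e \in edges G -> #|e| == 2.
Proof. by move=> eG; have /'forall_implyP/(_ _ eG) := edges_loopless G. Qed.

Lemma nb_edgesE (T : finType) (G : mgraph T) :
  \sum_x \sum_y mult G [set x; y] = 2 * nb_edges G.
Proof. by apply: sum_pairs => e; apply: mult_eq0. Qed.

Lemma mult_color_sum (k : nat) (T : finType) (c : kgraph k T) (e : {set T}) :
  mult (color_sum c) e = #|[set i | e \in edges (c i)]|.
Proof. by rewrite ffunE -sum1dep_card [RHS]big_mkcond. Qed.

Lemma mult_color_sum_le (k : nat) (T : finType) (c : kgraph k T) (e : {set T}) :
  mult (color_sum c) e <= k.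
Proof. by rewrite mult_color_sum -[leqRHS]card_ord max_card. Qed.

Lemma pull_subproof (S T : finType) (rho : S -> T) (G : sgraph T) :
  [forall e in [set e : {set S} | (#|e| == 2) && (rho @: e \in edges G)], #|e| == 2].
Proof. by apply/'forall_implyP => e; rewrite inE => /andP[]. Qed.

(** [rho] need not be injective: the cardinality test discards larger sets mapped onto an edge, and
    a pair collapsed to a point is not an edge because its image is not a pair. *)
Definition pull (k : nat) (S T : finType) (rho : S -> T) (c : kgraph k T) :
  kgraph k S := [ffun i => SGraph (pull_subproof rho (c i))].

Lemma mult_pull (k : nat) (S T : finType) (rho : S -> T) (c : kgraph k T) x y :
  mult (color_sum (pull rho c)) [set x; y] = mult (color_sum c) [set rho x; rho y].
Proof.
have [<- | xy] := eqVneq x y.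
  by rewrite !mult_eq0 // setUid cards1.
rewrite !mult_color_sum; apply: eq_card => i; rewrite !inE ffunE /= inE.
by rewrite imsetU1 imset_set1 cards2 xy.
Qed.

Definition complete (V : finType) (H : mgraph V) : Prop :=
  forall u v : V, u != v -> 0 < mult H [set u; v].

(** Composing with [rho] keeps the colors. It stays injective on the vertices of H since any two of
    them are joined by a copy, whose image must be a pair. *)
Lemma pull_multicolored (k : nat) (S T V : finType) (H : mgraph V) (rho : S -> T)
    (c : kgraph k T) :
  complete H -> has_multicolored H (pull rho c) -> has_multicolored H c.
Proof.
move=> complH /existsP[phi /existsP[col /and3P[/injectiveP phi_inj col_inj]]].
move=> /forallP copy; apply/existsP; exists [ffun v => rho (phi v)].
apply/existsP; exists col; rewrite col_inj /=.
have phiE (e : {set V}) : [ffun v => rho (phi v)] @: e = rho @: (phi @: e).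
  by rewrite -imset_comp; apply: eq_imset => v; rewrite ffunE.
apply/andP; split.
  apply/injectiveP => u v; rewrite !ffunE => uv; apply: contraTeq isT => uv'.
  have := copy (Tagged (fun e => 'I_(mult H e)) (Ordinal (complH u v uv'))).
  rewrite ffunE /= inE => /andP[_ /edges_card2].
  by rewrite !imsetU1 !imset_set1 uv setUid cards1.
apply/forallP => x; rewrite phiE.
by have := copy x; rewrite ffunE inE => /andP[].
Qed.

Definition clone (T : eqType) (x0 y0 z : T) : T := if z == x0 then y0 else z.

Lemma sum_clone1 (T : finType) (g : T -> nat) (x0 y0 : T) :
  \sum_z g (clone x0 y0 z) + g x0 = \sum_z g z + g y0.
Proof.
rewrite (bigD1 x0) // [in RHS](bigD1 x0) //= /clone eqxx.
rewrite (eq_bigr g) => [|z /negPf -> //]; lia.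
Qed.

(** The vertex x0 loses its own edges and gains those of y0, except the ones from y0 to x0 itself,
    as clones are not adjacent. The factors 2 come from ordered pairs, and terms are moved across to
    avoid subtraction. *)
Lemma sum_clone (T : finType) (f : T -> T -> nat) (x0 y0 : T) :
  (forall x y, f x y = f y x) -> (forall x, f x x = 0) ->
  \sum_x \sum_y f (clone x0 y0 x) (clone x0 y0 y) + 2 * (\sum_y f x0 y) + 2 * f x0 y0
  = \sum_x \sum_y f x y + 2 * (\sum_y f y0 y).
Proof.
move=> f_sym f0.
pose F x := \sum_y f x (clone x0 y0 y).
have F1 x : F x + f x x0 = \sum_y f x y + f x y0.
  by rewrite /F (sum_clone1 (f x)).
have sumF : \sum_x F (clone x0 y0 x) + F x0 = \sum_x F x + F y0.
  exact: (sum_clone1 F).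
have sum1 : \sum_x F x + \sum_x f x x0 = \sum_x \sum_y f x y + \sum_x f x y0.
  by rewrite -!big_split; apply: eq_bigr => x _; apply: F1.
have symE z : \sum_x f x z = \sum_y f z y by apply: eq_bigr => x _; apply: f_sym.
rewrite !symE in sum1.
have := F1 x0; have := F1 y0; rewrite !f0 (f_sym y0 x0) -/(F _).
have -> : \sum_x \sum_y f (clone x0 y0 x) (clone x0 y0 y) = \sum_x F (clone x0 y0 x) by [].
lia.
Qed.

Section Extremal.

Variables (k : nat) (T V : finType) (H : mgraph V).
Hypothesis complH : complete H.

Definition extremal_coloring (c : kgraph k T) : Prop :=
  ~~ has_multicolored H c /\
  forall c' : kgraph k T, ~~ has_multicolored H c' ->
    nb_edges (color_sum c') <= nb_edges (color_sum c).

Local Notation w c x y := (mult (color_sum c) [set x; y]).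

Lemma mult_pair_sym (c : kgraph k T) x y : w c x y = w c y x.
Proof. by rewrite setUC. Qed.

Lemma mult_pair_diag (c : kgraph k T) x : w c x x = 0.
Proof. by rewrite mult_eq0 // setUid cards1. Qed.

Lemma pull_clone_edges (c : kgraph k T) x0 y0 :
  nb_edges (color_sum (pull (clone x0 y0) c)) + \sum_y w c x0 y + w c x0 y0
  = nb_edges (color_sum c) + \sum_y w c y0 y.
Proof.
have := sum_clone x0 y0 (mult_pair_sym c) (mult_pair_diag c).
have -> : \sum_x \sum_y w c (clone x0 y0 x) (clone x0 y0 y)
    = \sum_x \sum_y w (pull (clone x0 y0) c) x y.
  by apply: eq_bigr => x _; apply: eq_bigr => y _; rewrite mult_pull.
rewrite !nb_edgesE; lia.
Qed.

Lemma extremal_degree (c : kgraph k T) x0 y0 : extremal_coloring c ->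
  \sum_y w c y0 y <= \sum_y w c x0 y + w c x0 y0.
Proof.
case=> Hc cmax; have := pull_clone_edges c x0 y0.
have := cmax (pull (clone x0 y0) c) (contra (pull_multicolored complH) Hc); lia.
Qed.

Lemma extremal_degree_eq (c : kgraph k T) x0 y0 : extremal_coloring c ->
  w c x0 y0 = 0 -> \sum_y w c x0 y = \sum_y w c y0 y.
Proof.
move=> cext w0; have := extremal_degree x0 y0 cext; have := extremal_degree y0 x0 cext.
rewrite (mult_pair_sym c y0) w0; lia.
Qed.

(** Making x a clone of y loses no edge, as x and y have equal degrees, so the new coloring is
    extremal too. There y and z are still non-adjacent, hence of equal degree; but the degree of y
    is unchanged while that of z dropped by the multiplicity of xz. *)
Lemma extremal_nonadjacent_trans (c : kgraph k T) x y z : extremal_coloring c ->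
  w c x y = 0 -> w c y z = 0 -> w c x z = 0.
Proof.
move=> cext xy yz; have [-> //|neq_xy] := eqVneq x y.
have [<- //|neq_yz] := eqVneq y z; have [-> |neq_xz] := eqVneq x z; first by apply: mult_pair_diag.
have deg_xy := extremal_degree_eq cext xy.
set c1 := pull (clone x y) c.
have c1ext : extremal_coloring c1.
  split; first by apply: contra (pull_multicolored complH) cext.1.
  move=> c' /cext.2; have := pull_clone_edges c x y; rewrite -/c1; lia.
have w1 u v : w c1 u v = w c (clone x y u) (clone x y v) by apply: mult_pull.
have yx : y == x = false by rewrite eq_sym (negPf neq_xy).
have zx : z == x = false by rewrite eq_sym (negPf neq_xz).
have c1yz : w c1 y z = 0 by rewrite w1 /clone yx zx.
have := extremal_degree_eq c1ext c1yz.
have deg1 u : u != x -> \sum_v w c1 u v + w c u x = \sum_v w c u v + w c u y.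
  move=> /negPf ux; rewrite -(sum_clone1 (fun v => w c u v) x y); congr (_ + _).
  by apply: eq_bigr => v _; rewrite w1 {1}/clone ux.
have := deg1 y (negbT yx); have := deg1 z (negbT zx).
have := extremal_degree_eq cext yz.
rewrite mult_pair_diag (mult_pair_sym c y x) xy (mult_pair_sym c z y) yz (mult_pair_sym c x z); lia.
Qed.

End Extremal.

(** * Balanced partitions and the convexity argument *)

Lemma mem_turan (q n : nat) (u v : 'I_n) :
  ([set u; v] \in edges (turan q n)) = (u != v %[mod q]).
Proof.
apply/imsetP/idP => [[[x y]] | uv]; last by exists (u, v); rewrite ?inE.
rewrite inE /= => xy E; have neq_xy : x != y by apply: contraNneq xy => ->.
have : #|[set u; v]| = 2 by rewrite E cards2 neq_xy.
have : u \in [set x; y] by rewrite -E !inE eqxx.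
have : v \in [set x; y] by rewrite -E !inE eqxx orbT.
rewrite !inE => /orP[] /eqP-> /orP[] /eqP->; rewrite ?setUid ?cards1 //.
by rewrite eq_sym.
Qed.

Lemma residue_class_card (q n i : nat) : 0 < q -> i < q ->
  \sum_(u < n) (u %% q == i) = n %/ q + (i < n %% q).
Proof.
move=> q_gt0 iq; elim: n => [|n IHn]; first by rewrite big_ord0 div0n mod0n ltn0.
rewrite big_ord_recr /= IHn divnS // modnS.
have := ltn_pmod n q_gt0; case: (boolP (q %| n.+1)) => [q_dvd | _].
  have -> : n %% q = q.-1.
    have := ltn_pmod n q_gt0; rewrite leq_eqVlt => /orP[/eqP qE | lt_q]; first by lia.
    by move: q_dvd; rewrite -addn1 /dvdn -modnDml addn1 modn_small.
  lia.
rewrite !add0n; lia.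
Qed.

Lemma sum_same_class (n q : nat) (f : 'I_n -> 'I_q) :
  \sum_x \sum_y (f x == f y) = \sum_i (\sum_x (f x == i)) ^ 2.
Proof.
have E x y : (f x == f y : nat) = \sum_i (f x == i) * (f y == i).
  rewrite (bigD1 (f x)) //= eqxx mul1n big1 ?addn0 1?eq_sym //.
  by move=> i; rewrite eq_sym => /negPf ->.
under eq_bigr do under eq_bigr do rewrite E.
under eq_bigr do rewrite exchange_big.
rewrite exchange_big; apply: eq_bigr => i _ /=.
under eq_bigr do rewrite -big_distrr /=.
by rewrite -big_distrl /= mulnn.
Qed.

Lemma sum_class_sizes (n q : nat) (f : 'I_n -> 'I_q) :
  \sum_i \sum_x (f x == i) = n.
Proof.
rewrite exchange_big /= (eq_bigr (fun=> 1)) ?sum1_card ?card_ord // => x _.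
by rewrite (bigD1 (f x)) //= eqxx big1 // => i; rewrite eq_sym => /negPf ->.
Qed.

Lemma count_mktuple (A : Type) (n : nat) (h : 'I_n -> A) (P : pred A) :
  count P [tuple h i | i < n] = \sum_i P (h i).
Proof.
rewrite /= count_map -sum1_count big_mkcond /= big_enum /=.
by apply: eq_bigr => i _; case: (P _).
Qed.

(** With only the values a and a + 1, the sum determines how often each occurs. The identity [cnt]
    says so for an arbitrary predicate, being linear in [h i - a], which is 0 or 1. *)
Lemma balanced_perm (q a : nat) (g g' : 'I_q -> nat) :
  (forall i, a <= g i <= a.+1) -> (forall i, a <= g' i <= a.+1) ->
  \sum_i g i = \sum_i g' i ->
  exists p : {perm 'I_q}, forall i, g' i = g (p i).
Proof.
move=> ga ga' eq_sum.
have cnt (P : pred nat) (h : 'I_q -> nat) : (forall i, a <= h i <= a.+1) ->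
    \sum_i (P (h i) : nat) + (\sum_i h i - q * a) * P a = q * P a + (\sum_i h i - q * a) * P a.+1.
  move=> ha; have -> : \sum_i h i - q * a = \sum_i (h i - a).
    rewrite sumnB; last by move=> i _; case/andP: (ha i).
    by rewrite sum_nat_const card_ord.
  have -> : q * P a = \sum_(i < q) (P a : nat) by rewrite sum_nat_const card_ord.
  rewrite !big_distrl -!big_split; apply: eq_bigr => i _ /=.
  have /andP[ai ia] := ha i; have [-> | ->] : h i = a \/ h i = a.+1 by lia.
    by rewrite subnn !mul0n.
  by rewrite subSnn !mul1n addnC.
have /tuple_permP[p Ep] : perm_eq [tuple g' i | i < q] [tuple g i | i < q].
  apply/seq.permP => P; rewrite !count_mktuple.
  have := cnt P _ ga; have := cnt P _ ga'; rewrite eq_sum; lia.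
exists p => i.
have : tnth [tuple g' i | i < q] i = tnth [tuple tnth [tuple g i | i < q] (p i) | i < q] i.
  by congr tnth; apply: val_inj.
by rewrite !tnth_mktuple.
Qed.

Lemma class_perm (n q : nat) (f f' : 'I_n -> 'I_q) :
  (forall i, \sum_x (f x == i) = \sum_x (f' x == i)) ->
  exists s : {perm 'I_n}, forall x, f' x = f (s x).
Proof.
move=> eq_cnt.
have /tuple_permP[s Es] : perm_eq [tuple f' x | x < n] [tuple f x | x < n].
  apply/allP => i _ /=; by rewrite !count_mktuple eq_cnt.
exists s => x.
have : tnth [tuple f' x | x < n] x = tnth [tuple tnth [tuple f x | x < n] (s x) | x < n] x.
  by congr tnth; apply: val_inj.
by rewrite !tnth_mktuple.
Qed.

(** This is (b - a)(b - a - 1) >= 0, an equality exactly for b = a and b = a + 1; summed over the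
    classes it replaces the convexity of the square. *)
Lemma balanced_square (a b : nat) : (2 * a + 1) * b <= b ^ 2 + a * a.+1.
Proof.
rewrite -mulnn; have [/subnK <- | /subnK <-] := leqP b a.
  by move: (a - b) => e; lia.
by move: (b - a.+1) => e; lia.
Qed.

Lemma balanced_square_eq (a b : nat) :
  (2 * a + 1) * b = b ^ 2 + a * a.+1 -> a <= b <= a.+1.
Proof.
rewrite -mulnn; have [/subnK <- | /subnK <-] := leqP b a.
  by move: (a - b) => e; nia.
by move: (b - a.+1) => e; nia.
Qed.

Lemma balanced_square_val (a b : nat) :
  a <= b <= a.+1 -> (2 * a + 1) * b = b ^ 2 + a * a.+1.
Proof. by move=> H; have [-> | ->] : b = a \/ b = a.+1 by [lia]; lia. Qed.

Lemma leq_sum_eq (I : finType) (F G : I -> nat) :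
  (forall i, F i <= G i) -> \sum_i G i <= \sum_i F i -> forall i, F i = G i.
Proof.
move=> FG le_GF i; apply/eqP; rewrite eqn_leq FG /= leqNgt; apply/negP => lt_FG.
move: le_GF; rewrite leqNgt => /negP[].
by rewrite (bigD1 i) // [ltnRHS](bigD1 i) //= -addSn leq_add // leq_sum.
Qed.

Lemma turan_numberE (q n : nat) :
  \sum_(x < n) \sum_(y < n) (x != y %[mod q]) = 2 * turan_number q n.
Proof.
have -> : turan_number q n = \sum_e (e \in edges (turan q n)).
  by rewrite /turan_number -sum1_card big_mkcond.
rewrite -sum_pairs => [|e e2].
  by apply: eq_bigr => x _; apply: eq_bigr => y _; rewrite mem_turan.
by apply/eqP; rewrite eqb0; apply: contra e2; apply: edges_card2.
Qed.

(** Pairs inside classes number the sum of the squared class sizes, which is least for the residue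
    classes. The lower bound on the total weight forces equality throughout: sizes are balanced and
    [w] equals k between classes. A permutation of the classes, then one of the vertices, turn f
    into the residues. *)
Lemma turan_extremal (n q k : nat) (f : 'I_n -> 'I_q) (w : 'I_n -> 'I_n -> nat) :
  0 < q -> 0 < k ->
  (forall x y, w x y <= k) -> (forall x y, f x = f y -> w x y = 0) ->
  k * (2 * turan_number q n) <= \sum_x \sum_y w x y ->
  exists s : {perm 'I_n}, forall x y, w (s x) (s y) = k * (x != y %[mod q]).
Proof.
move=> q_gt0 k_gt0 wk w0; rewrite -turan_numberE => w_large.
pose r (x : 'I_n) : 'I_q := Ordinal (ltn_pmod x q_gt0).
pose a := n %/ q.
have r_size i : \sum_x (r x == i) = a + (i < n %% q).
  by rewrite -(residue_class_card _ q_gt0 (ltn_ord i)).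
have tot (g : 'I_n -> 'I_q) :
    \sum_x \sum_y (g x != g y) + \sum_x \sum_y (g x == g y) = n * n.
  rewrite -big_split /= -[X in _ = X * _]card_ord -sum_nat_const.
  apply: eq_bigr => x _; rewrite -big_split /= -[RHS]muln1 -[X in _ = X * _]card_ord.
  by rewrite -sum_nat_const; apply: eq_bigr => y _; case: eqP.
pose b (i : 'I_q) := \sum_x (f x == i).
have sq_r : (2 * a + 1) * n = \sum_x \sum_y (r x == r y) + q * (a * a.+1).
  rewrite sum_same_class -{1}(sum_class_sizes r) big_distrr /=.
  rewrite -[X in _ + X * _](card_ord q) -sum_nat_const -big_split /=.
  by apply: eq_bigr => i _; rewrite r_size; apply: balanced_square_val; lia.
have sq_f : (2 * a + 1) * n <= \sum_x \sum_y (f x == f y) + q * (a * a.+1).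
  rewrite sum_same_class -{1}(sum_class_sizes f) big_distrr /=.
  rewrite -[X in _ + X * _](card_ord q) -sum_nat_const -big_split /=.
  by apply: leq_sum => i _; apply: balanced_square.
have w_le x y : w x y <= k * (f x != f y).
  by case: eqP => [/w0->|_] //=; rewrite muln1.
have w_sum : \sum_x \sum_y w x y <= k * (\sum_x \sum_y (f x != f y)).
  rewrite big_distrr; apply: leq_sum => x _; rewrite big_distrr.
  by apply: leq_sum => y _; apply: w_le.
have eq_rf : \sum_x \sum_y (f x == f y) <= \sum_x \sum_y (r x == r y).
  have : k * (\sum_x \sum_y (r x != r y)) <= k * (\sum_x \sum_y (f x != f y)).
    exact: leq_trans w_large w_sum.
  rewrite leq_pmul2l //; have := tot r; have := tot f; lia.
have b_bal i : a <= b i <= a.+1.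
  apply: balanced_square_eq.
  apply: (@leq_sum_eq _ (fun i => (2 * a + 1) * b i) (fun i => b i ^ 2 + a * a.+1)).
    by move=> j; apply: balanced_square.
  rewrite big_split sum_nat_const card_ord -big_distrr /= (sum_class_sizes f).
  by rewrite sq_r leq_add2r -sum_same_class.
have wE x y : w x y = k * (f x != f y).
  have sumE : \sum_x \sum_y k * (f x != f y) <= \sum_x \sum_y w x y.
    apply: leq_trans w_large; under eq_bigr do rewrite -big_distrr.
    rewrite -big_distrr leq_mul2l /=; apply/orP; right.
    change (\sum_x \sum_y (f x != f y) <= \sum_x \sum_y (r x != r y)).
    have le_rf : \sum_x \sum_y (r x == r y) <= \sum_x \sum_y (f x == f y).
      by move: sq_f; rewrite sq_r leq_add2r.
    have := tot r; have := tot f; lia.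
  rewrite !pair_big /= in sumE.
  exact: (@leq_sum_eq _ (fun p => w p.1 p.2) (fun p => k * (f p.1 != f p.2))
    (fun p => w_le p.1 p.2) sumE (x, y)).
have [p pE] : exists p : {perm 'I_q}, forall i : 'I_q, a + (i < n %% q) = b (p i).
  apply: (@balanced_perm q a b (fun i : 'I_q => a + (i < n %% q))) => // [i|].
    by case: (_ < _); lia.
  rewrite [LHS](sum_class_sizes f) -[LHS](sum_class_sizes r).
  by apply: eq_bigr => i _; rewrite r_size.
have [s sE] : exists s : {perm 'I_n}, forall x, p (r x) = f (s x).
  apply: class_perm => i; rewrite -(permKV p i) -/(b _) -pE -r_size.
  by apply: eq_bigr => x _; rewrite (inj_eq perm_inj).
by exists s => x y; rewrite wE -!sE (inj_eq perm_inj).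
Qed.

(** * Structure of H *)

Lemma chromatic_number_le (V : finType) (H : mgraph V) (q : nat) :
  colorable (underlying H) q -> chromatic_number H <= q.
Proof. by rewrite /chromatic_number; case: ex_minnP => m _; apply. Qed.

(** If u and v were not joined, giving v the color of u and every other vertex its own color would
    use only #|V| - 1 colors. *)
Lemma critical_complete (V : finType) (H : mgraph V) :
  color_critical #|V| H -> complete H.
Proof.
move=> [chi _] u v uv; rewrite lt0n; apply: contra_eqN chi => /eqP uvH.
suff col : colorable (underlying H) #|V|.-1.
  rewrite neq_ltn; apply/orP; left; apply: leq_ltn_trans (chromatic_number_le col) _.
  by rewrite prednK //; apply/card_gt0P; exists u.
rewrite -(cardsC1 v); have uA : u \in [set~ v] by rewrite !inE.
have cloneA z : clone v u z \in [set~ v].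
  by rewrite /clone; case: eqP => [_|/eqP zv] //; rewrite !inE.
apply/existsP; exists [ffun z => enum_rank_in uA (clone v u z)].
apply/forallP => z; apply/forallP => z'; apply/implyP => zz'; rewrite !ffunE.
have neq_zz' : z != z'.
  by apply: contraTneq (edges_card2 zz') => ->; rewrite setUid cards1.
apply: contraTneq zz' => /(enum_rank_in_inj (cloneA z) (cloneA z')).
rewrite /clone inE -eqn0Ngt; case: (eqVneq z v) => [->|zv]; case: (eqVneq z' v) => [->|z'v].
- by move=> _; rewrite mult_eq0 // setUid cards1.
- by move=> <-; rewrite setUC uvH.
- by move=> ->; rewrite uvH.
by move=> E; rewrite E eqxx in neq_zz'.
Qed.

(** If the critical edge had a parallel copy, deleting one copy would not change the underlying
    graph, nor the chromatic number. *)
Lemma critical_simple_edge (V : finType) (H : mgraph V) (r : nat) :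
  color_critical r H -> exists x y, x != y /\ mult H [set x; y] = 1.
Proof.
move=> [chi [e e_gt0 chi_e]].
have /cards2P[x [y [xy eE]]] : #|e| == 2.
  by apply: contraTT e_gt0 => /mult_eq0 ->.
exists x, y; split=> //; rewrite -eE; apply/eqP; rewrite eqn_leq e_gt0 andbT.
rewrite leqNgt; apply: contraL chi_e => e_gt1; rewrite -leqNgt -chi.
apply: chromatic_number_le; rewrite /chromatic_number; case: ex_minnP => m col _.
suff -> : underlying H = underlying (del_edge H e) by [].
apply: val_inj; apply/setP => f; rewrite !inE /= ffunE.
by case: eqP => [->|_]; rewrite ?subn0 // subn_gt0 e_gt1.
Qed.

(** * Embedding H, and the conditions on k *)

Lemma card_edge_copies (V : finType) (H : mgraph V) (P : pred {set V}) :
  #|[set X : edge_copy H | P (tag X)]| = \sum_(e | P e) mult H e.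
Proof.
rewrite -sum1dep_card.
transitivity (\sum_(e | P e) \sum_(j < mult H e) 1); last first.
  by apply: eq_bigr => e _; rewrite sum1_card card_ord.
by rewrite sig_big_dep /=; apply: eq_bigl => X; rewrite andbT.
Qed.

Lemma perm_pair_move (V : finType) (x y x' y' : V) : x != y -> x' != y' ->
  exists p : {perm V}, p x = x' /\ p y = y'.
Proof.
move=> xy xy'; pose z := tperm x x' y.
have zx' : z != x' by rewrite /z -{2}(tpermL x x') (inj_eq perm_inj) eq_sym.
exists (tperm x x' * tperm z y')%g; rewrite !permM -/z !tpermL.
by rewrite tpermD // eq_sym.
Qed.

Lemma pointed_bijection (V T : finType) (x y : V) (a b : T) (A : {set T}) :
  x != y -> b \in A -> a \notin A -> #|V| = #|A|.+1 ->
  exists beta : V -> T,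
    [/\ injective beta, beta x = a, beta y = b & beta @: [set~ x] = A].
Proof.
move=> xy bA aA cardV; pose S := a |: A.
have cardS : #|V| = #|S| by rewrite cardsU1 aA.
pose beta0 v := enum_val (cast_ord cardS (enum_rank v)).
have beta0_inj : injective beta0.
  by move=> u v /enum_val_inj /cast_ord_inj /enum_rank_inj.
have imbeta0 : beta0 @: [set: V] = S.
  apply/eqP; rewrite eqEcard card_imset // cardsT cardS leqnn andbT.
  by apply/subsetP => _ /imsetP[v _ ->]; apply: enum_valP.
have [x' _ ax'] : exists2 v, v \in [set: V] & a = beta0 v.
  by apply/imsetP; rewrite imbeta0 setU11.
have [y' _ by'] : exists2 v, v \in [set: V] & b = beta0 v.
  by apply/imsetP; rewrite imbeta0 setU1r.
have xy' : x' != y' by apply: contraNneq aA => E; rewrite ax' E -by'.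
have [p [px py]] := perm_pair_move xy xy'.
have inj : injective (beta0 \o p) by apply: inj_comp => //; apply: perm_inj.
exists (beta0 \o p); split; rewrite //= ?px ?py //.
apply/eqP; rewrite eqEcard card_imset // cardsC1 cardV leqnn andbT.
apply/subsetP => _ /imsetP[v vx ->]; rewrite !inE in vx.
have : (beta0 \o p) v \in S by rewrite -imbeta0; apply: (imset_f beta0 (in_setT (p v))).
case/setU1P => // E; case/eqP: vx; apply: inj.
by rewrite E /= px.
Qed.

Lemma multicolored_of_clique (k q s : nat) (T V : finType) (H : mgraph V)
    (c : kgraph k T) (x y : V) (T0 : {set T}) (a : T) :
  let d u v := k - mult (color_sum c) [set u; v] in
  4 <= q -> #|V| = q.+1 -> complete H -> x != y -> mult H [set x; y] = 1 ->
  2 * nb_edges H = 2 * s + q.+1 * q ->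
  q * (2 * s + q.+1 * q) < 2 * (q.-1 * k) + 2 * q ->
  q * (4 * s + q.+1 * q.+1 + 4) < 2 * (q.+1 * k) ->
  #|T0| = q ->
  (forall v, v \in T0 -> q * (\sum_(u in T0 :\ v) d u v) <= q.-1 * k) ->
  (forall t, t \in T0 -> d t a < k) -> \sum_(t in T0) d t a <= k ->
  has_multicolored H c.
Proof.
move=> d q4 cardV complH xy mxy hE cond1 cond2 T0q T0deg aT0 Da.
have k_gt0 : 0 < k by case: (k) cond2 => //; rewrite muln0.
have d_sym u v : d u v = d v u by rewrite /d setUC.
have aT0' : a \notin T0.
  apply/negP => /aT0; rewrite /d mult_eq0 ?subn0 ?ltnn //.
  by rewrite setUid cards1.
have [b0 b0T0] : exists t, t \in T0 by apply/card_gt0P; rewrite T0q; lia.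
(* [b] is the lightest partner of [a]; the simple edge xy goes to ab, where one color is enough. *)
pose b := [arg max_(t > b0 in T0) d t a].
have [bT0 bmax] : b \in T0 /\ forall t, t \in T0 -> d t a <= d b a.
  by rewrite /b; case: arg_maxnP.
have [beta [beta_inj betax betay betaT0]] :
    exists beta : V -> T, [/\ injective beta, beta x = a, beta y = b & beta @: [set~ x] = T0].
  by apply: pointed_bijection; rewrite ?cardV ?T0q.
have betaT v : v != x -> beta v \in T0.
  by move=> vx; rewrite -betaT0 imset_f // !inE.
have beta2 u v : beta @: [set u; v] = [set beta u; beta v].
  by rewrite imsetU1 imset_set1.
pose w (e : {set V}) := mult (color_sum c) (beta @: e).
have wk e : w e <= k by apply: mult_color_sum_le.
have [t txy tP] : exists2 t : {perm V}, [set t x; t y] = [set x; y] &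
    forall e : {set V}, #|e| = 2 ->
      \sum_(f : {set V} | (#|f| == 2) && (w f <= w e)) mult H (t @: f) <= w e.
  apply: (@light_labelling V x y (mult H) w q k s) => //.
  - by move=> e /eqP/cards2P[u [v [uv ->]]]; apply: complH.
  - rewrite -hE; congr (2 * _); rewrite /nb_edges [RHS](bigID (fun e : {set V} => #|e| == 2)) /=.
    by rewrite [X in _ = _ + X]big1 ?addn0 // => e; apply: mult_eq0.
  - move=> v vx; apply: leq_trans (T0deg (beta v) (betaT v vx)).
    rewrite leq_mul2l; apply/orP; right.
    (* [F] extends the deficits by zero to all sets, so that [sum_star] turns the sum over pairs at
       v into a sum over vertices. *)
    pose F (e : {set V}) := if (#|e| == 2) && (x \notin e) then k - w e else 0.
    have F0 (e : {set V}) : #|e| != 2 -> F e = 0 by rewrite /F => /negPf ->.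
    have -> : \sum_(e : {set V} | [&& #|e| == 2, v \in e & x \notin e]) (k - w e)
        = \sum_(e : {set V} | v \in e) F e.
      rewrite -big_mkcondr; apply: eq_bigl => e /=.
      by case: (#|e| == 2); rewrite ?andbF.
    rewrite -(sum_star v F0) [leqRHS](_ : _ = \sum_(u in [set~ x] :\ v) d (beta u) (beta v)).
      rewrite [leqRHS]big_mkcond /=; apply: leq_sum => u _; rewrite /F !inE cards2.
      have [->|uv] := eqVneq u v; first by rewrite ?eqxx.
      rewrite /= negb_or !(eq_sym x) vx /=.
      by case: ifP => //= _; rewrite /w /d beta2 setUC.
    rewrite -(big_imset (fun t => d t (beta v)) (in2W beta_inj)) /=; apply: eq_bigl => u.
    rewrite inE -betaT0 inE; apply/andP/imsetP => [[uv /imsetP[z zx uE]] | [z]].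
      by exists z; rewrite // inE zx inE andbT; apply: contraNneq uv => <-; rewrite uE.
    by rewrite inE inE => /andP[zv zx] ->; rewrite (inj_eq beta_inj) zv imset_f.
  - apply: leq_trans Da.
    pose F (e : {set V}) := if #|e| == 2 then k - w e else 0.
    have F0 (e : {set V}) : #|e| != 2 -> F e = 0 by rewrite /F => /negPf ->.
    have -> : \sum_(e : {set V} | (#|e| == 2) && (x \in e)) (k - w e)
        = \sum_(e : {set V} | x \in e) F e.
      by rewrite -big_mkcondr; apply: eq_bigl => e /=; rewrite andbC.
    rewrite -(sum_star x F0) -betaT0 (big_imset _ (in2W beta_inj)) /=.
    rewrite [leqRHS]big_mkcond /=; apply: leq_sum => u _; rewrite /F !inE cards2.
    rewrite (eq_sym u x); case: (x == u) => //=.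
    by rewrite /w /d beta2 betax setUC.
  - move=> e e2 xe; have [u ux ->] := card2_other e2 xe.
    rewrite /w !beta2 betax betay; have := bmax _ (betaT u ux); have := aT0 _ bT0.
    have := mult_color_sum_le c [set a; beta u]; have := mult_color_sum_le c [set a; b].
    rewrite /d ![[set _; a]]setUC; lia.
(* The inverse of t makes the host pair [beta @: f] receive the copies of [t @: f], as in
   [light_labelling]. *)
pose phi := [ffun v => beta ((t^-1)%g v)].
have phi_inj : injective phi by move=> u v; rewrite !ffunE => /beta_inj /perm_inj.
have phiE (f : {set V}) : phi @: (t @: f) = beta @: f.
  by rewrite -imset_comp; apply: eq_imset => v; rewrite /= ffunE permK.
have t_bij : {on [pred f : {set V} | true], bijective (fun f : {set V} => t @: f)}.
  exists (fun f : {set V} => (t^-1)%g @: f) => f _; rewrite -imset_comp.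
    by rewrite -[RHS]imset_id; apply: eq_imset => v; rewrite /= permK.
  by rewrite -[RHS]imset_id; apply: eq_imset => v; rewrite /= permKV.
pose C (X : edge_copy H) := [set i | phi @: tag X \in edges (c i)].
have CE X : #|C X| = mult (color_sum c) (phi @: tag X) by rewrite mult_color_sum.
have [X | col [col_inj colC]] := @distinct_representatives _ _ C.
  pose e := (t^-1)%g @: tag X.
  have eX : t @: e = tag X.
    by rewrite /e -imset_comp -[RHS]imset_id; apply: eq_imset => v; rewrite /= permKV.
  have e2 : #|e| = 2.
    rewrite card_imset; last exact: perm_inj.
    have X_gt0 : 0 < mult H (tag X) := leq_ltn_trans (leq0n _) (ltn_ord (tagged X)).
    by apply/eqP; apply: contraTT X_gt0 => /mult_eq0 ->.
  have CX : #|C X| = w e by rewrite CE -eX phiE.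
  rewrite CX; apply: leq_trans (tP e e2).
  have -> : [set Y | #|C Y| <= w e] = [set Y : edge_copy H |
      mult (color_sum c) (phi @: tag Y) <= w e] by apply/setP => Y; rewrite !inE CE.
  rewrite (@card_edge_copies V H (fun f => mult (color_sum c) (phi @: f) <= w e)).
  rewrite (reindex _ (onW_bij _ (_ : bijective (fun f : {set V} => t @: f)))) /=; last first.
    by case: t_bij => g gK Kg; exists g => f; [apply: gK | apply: Kg].
  rewrite (bigID (fun f : {set V} => #|f| == 2)) /= [X in _ + X <= _]big1 ?addn0.
    by rewrite leq_eqVlt; apply/orP; left; apply/eqP; apply: eq_bigl => f; rewrite phiE andbC.
  move=> f /andP[_ f2]; apply: mult_eq0.
  by rewrite card_imset //; apply: perm_inj.
apply/existsP; exists phi; apply/existsP; exists col.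
apply/and3P; split=> //; first by apply/injectiveP.
by apply/forallP => X; have := colC X; rewrite inE.
Qed.

(** The bounds on k are multiplied by q - 1 and by 2(q + 1), and negative terms are moved across so
    that both read in nat. *)
Lemma k_large_natural (q h k : nat) : 4 <= q ->
  (Num.max
       ((q.+1%:R - 1) / (q.+1%:R - 2%:R) * (h%:R - 1))
       (2%:R * ((q.+1%:R - 1) / q.+1%:R)
          * (h%:R - q.+1%:R * (q.+1%:R - 2%:R) / 4%:R + 1))
       < k%:R :> rat)%R ->
  q * h < q.-1 * k + q /\ q * (4 * h + 4) < 2 * (q.+1 * k) + q * (q.+1 * q.-1).
Proof.
case: q => // p p3; rewrite gt_max => /andP[].
have -> : (p.+2%:R - 1 = p.+1%:R :> rat)%R by rewrite -[p.+2]addn1 natrD addrK.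
have -> : (p.+2%:R - 2%:R = p%:R :> rat)%R by rewrite -[p.+2]addn2 natrD addrK.
have p_gt0 : (0 < p%:R :> rat)%R by rewrite ltr0n; lia.
have r_gt0 : (0 < p.+2%:R :> rat)%R by rewrite ltr0n.
rewrite mulrAC ltr_pdivrMr // => H1.
have -> : (2%:R * (p.+1%:R / p.+2%:R) * (h%:R - p.+2%:R * p%:R / 4%:R + 1)
  = (p.+1%:R * (4%:R * h%:R + 4%:R) - p.+1%:R * (p.+2%:R * p%:R)) / (2%:R * p.+2%:R) :> rat)%R.
  move: r_gt0; move: (p.+2%:R)%R (p.+1%:R)%R (p%:R)%R => R Q P /gt_eqF/negbT R0.
  by field.
rewrite ltr_pdivrMr ?mulr_gt0 // => H2; split; rewrite -(ltr_nat rat) /= !(natrD, natrM) -?natr1;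
  by move: H1 H2; rewrite -?natr1; lra.
Qed.

Lemma turan_free (k q n : nat) (V : finType) (H : mgraph V) :
  0 < q -> q < #|V| -> complete H -> ~~ has_multicolored H (kturan k q n).
Proof.
move=> q_gt0 qV complH; apply/existsP => -[phi /existsP[col]].
case/and3P=> _ _ /forallP copies.
have res_inj : injective (fun v => Ordinal (ltn_pmod (phi v) q_gt0)).
  move=> u v [uv]; apply: contraTeq isT => neq_uv.
  have := copies (Tagged (fun e => 'I_(mult H e)) (Ordinal (complH u v neq_uv))).
  by rewrite ffunE /= imsetU1 imset_set1 mem_turan uv eqxx.
by have := leq_card _ res_inj; rewrite card_ord leqNgt qV.
Qed.

Lemma nb_edges_kturan (k q n : nat) :
  nb_edges (color_sum (kturan k q n)) = k * turan_number q n.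
Proof.
rewrite /nb_edges (eq_bigr (fun e => k * (e \in edges (turan q n)))).
  by rewrite -big_distrr /= /turan_number -sum1_card [in RHS]big_mkcond.
move=> e _; rewrite ffunE (eq_bigr (fun=> e \in edges (turan q n) : nat)).
  by rewrite sum_nat_const card_ord.
by move=> i _; rewrite ffunE.
Qed.

(** * Extremal colorings *)

Section Main.

Variables (k q s : nat) (V : finType) (H : mgraph V) (x y : V).
Hypotheses (q4 : 4 <= q) (cardV : #|V| = q.+1) (complH : complete H)
  (xy : x != y) (mxy : mult H [set x; y] = 1)
  (hE : 2 * nb_edges H = 2 * s + q.+1 * q)
  (cond1 : q * (2 * s + q.+1 * q) < 2 * (q.-1 * k) + 2 * q)
  (cond2 : q * (4 * s + q.+1 * q.+1 + 4) < 2 * (q.+1 * k)).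

Let k_gt0 : 0 < k.
Proof. by case: (k) cond2 => //; rewrite muln0. Qed.

Let q_gt0 : 0 < q.
Proof. by lia. Qed.

Lemma turan_degree (n : nat) (u : 'I_n) :
  n <= \sum_(v < n) (u != v %[mod q]) + n %/ q + 1.
Proof.
have := residue_class_card n q_gt0 (ltn_pmod u q_gt0).
have : \sum_(v < n) (v %% q == u %% q) + \sum_(v < n) (u != v %[mod q]) = n.
  rewrite -big_split /= -[RHS]card_ord -sum1_card; apply: eq_bigr => v _.
  by rewrite eq_sym; case: eqP.
by case: (_ < _); lia.
Qed.

(** All degrees are within k of each other, so the degree of u is at least the average minus k, and
    the average is at least that of the Turan coloring, whose vertices miss at most n/q + 1 vertices
    each. The deficits at u thus sum to at most kn/q + 2k. *)
Lemma extremal_deficit (n : nat) (c : kgraph k 'I_n) u : extremal_coloring H c ->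
  q * (\sum_v (k - mult (color_sum c) [set u; v])) <= k * n + 2 * (k * q).
Proof.
move=> cext.
have deg_le v : \sum_z mult (color_sum c) [set v; z]
    <= \sum_z mult (color_sum c) [set u; z] + k.
  apply: leq_trans (extremal_degree complH u v cext) _.
  by rewrite leq_add2l mult_color_sum_le.
have Turan_le : k * (2 * turan_number q n) <= 2 * nb_edges (color_sum c).
  rewrite mulnCA leq_mul2l -nb_edges_kturan; apply: cext.2.
  by apply: turan_free; rewrite ?cardV.
have n_gt0 : 0 < n by apply: leq_ltn_trans (ltn_ord u).
have sum_le : 2 * nb_edges (color_sum c) <= n * (\sum_z mult (color_sum c) [set u; z] + k).
  rewrite -nb_edgesE -[X in _ <= X * _]card_ord -sum_nat_const.
  by apply: leq_sum => v _.
have turan_ge : n * n <= 2 * turan_number q n + n * (n %/ q + 1).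
  have sum_const m : n * m = \sum_(v < n) m by rewrite sum_nat_const card_ord.
  rewrite -turan_numberE [n * n]sum_const [n * (_ + 1)]sum_const -big_split /=.
  by apply: leq_sum => v _; rewrite addnA; apply: turan_degree.
have deg_u : k * n <= \sum_z mult (color_sum c) [set u; z] + k + k * (n %/ q + 1).
  rewrite -(leq_pmul2l n_gt0) mulnDr.
  have : k * (n * n) <= k * (2 * turan_number q n + n * (n %/ q + 1)).
    by rewrite leq_mul2l turan_ge orbT.
  rewrite mulnCA mulnDr [k * (n * _)]mulnCA => /leq_trans; apply.
  by rewrite leq_add2r (leq_trans Turan_le).
have -> : \sum_v (k - mult (color_sum c) [set u; v])
    = k * n - \sum_z mult (color_sum c) [set u; z].
  rewrite sumnB => [|v _]; last exact: mult_color_sum_le.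
  by rewrite sum_nat_const card_ord mulnC.
apply: (@leq_trans (q * (k * (n %/ q) + 2 * k))).
  rewrite leq_mul2l; apply/orP; right; move: deg_u.
  by move: (n %/ q) (\sum_(z < n) _) => m S; clear; lia.
by have := leq_mul (leqnn k) (leq_divM n q); move: (n %/ q) => m; clear; lia.
Qed.

Lemma extremal_is_turan (n : nat) (c : kgraph k 'I_n) :
  10 * (k ^ 3 * q ^ 3) < n -> extremal_coloring H c ->
  exists p : {perm 'I_n}, forall u v,
    mult (color_sum c) [set p u; p v] = k * (u != v %[mod q]).
Proof.
move=> n_large cext; pose w u v := mult (color_sum c) [set u; v].
pose d u v := k - w u v.
have wk u v : w u v <= k by apply: mult_color_sum_le.
have d_eqk u v : d u v = k -> w u v = 0 by rewrite /d; have := wk u v; lia.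
have dE u v : w u v = 0 -> d u v = k by rewrite /d => ->; rewrite subn0.
have [] := @clique_with_extension 'I_n d k q _ _ _ _ _ k_gt0 _ _.
- by move=> u v; rewrite /d /w setUC.
- by move=> u v; apply: leq_subr.
- by move=> u; apply: dE; rewrite /w mult_eq0 // setUid cards1.
- move=> u v z /d_eqk uv /d_eqk vz; apply: dE.
  exact: (extremal_nonadjacent_trans complH cext uv vz).
- by move=> u; rewrite card_ord; apply: extremal_deficit.
- by apply: leq_trans q4.
- by rewrite card_ord.
move=> T0 [T0q T0deg [cover | [a aT0 Da]]]; last first.
  case/negP: cext.1.
  exact: (multicolored_of_clique q4 cardV complH xy mxy hE cond1 cond2 T0q T0deg aT0 Da).
have [t0 t0T0] : exists t, t \in T0 by apply/card_gt0P; rewrite T0q.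
have coverb u : exists t, (t \in T0) && (d t u == k).
  by have [t tT0 tu] := cover u; exists t; rewrite tT0 tu eqxx.
(* [g u] represents the non-adjacency class of u inside [T0], so vertices with the same image are
   non-adjacent by transitivity. *)
pose g u := xchoose (coverb u).
have gP u : g u \in T0 /\ d (g u) u = k by have /andP[? /eqP] := xchooseP (coverb u).
pose f u : 'I_q := cast_ord T0q (enum_rank_in t0T0 (g u)).
apply: (@turan_extremal n q k f w) => //.
  move=> u v /cast_ord_inj /(enum_rank_in_inj (gP u).1 (gP v).1) guv.
  have guu := d_eqk _ _ (gP u).2; have gvv := d_eqk _ _ (gP v).2.
  rewrite -guv /w in gvv; rewrite /w setUC in guu.
  exact: (extremal_nonadjacent_trans complH cext guu gvv).
rewrite nb_edgesE mulnCA leq_mul2l -nb_edges_kturan /=; apply: cext.2.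
by apply: turan_free; rewrite ?cardV.
Qed.

(** Multiplicity k puts a pair in all k colors and multiplicity 0 in none, so the sum determines
    every single color. *)
Lemma extremal_colors (n : nat) (c : kgraph k 'I_n) (p : {perm 'I_n}) :
  (forall u v, mult (color_sum c) [set p u; p v] = k * (u != v %[mod q])) ->
  forall i, sgraph_iso_by p (turan q n) (c i).
Proof.
move=> cE i; split=> [|e]; first by exists (p^-1)%g; [apply: permK | apply: permKV].
have pe2 : #|p @: e| = #|e| by rewrite card_imset //; apply: perm_inj.
have [/cards2P[u [v [uv ->]]] | e2] := boolP (#|e| == 2); last first.
  by rewrite (contraNF (@edges_card2 _ _ _) e2) (contraNF (@edges_card2 _ _ _)) // pe2.
rewrite mem_turan imsetU1 imset_set1; have := cE u v; rewrite mult_color_sum.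
case: (u != v %[mod q]) => /=; rewrite ?muln1 ?muln0 => cuv.
  have /eqP/setP/(_ i) : [set i | [set p u; p v] \in edges (c i)] == setT.
    by rewrite eqEcard subsetT cuv cardsT card_ord leqnn.
  by rewrite !inE.
by have /setP/(_ i) := cards0_eq cuv; rewrite !inE.
Qed.

End Main.

Lemma complete_nb_edges (V : finType) (H : mgraph V) :
  complete H -> 'C(#|V|, 2) <= nb_edges H.
Proof.
move=> complH; rewrite -cardsT -cards_draws -sum1_card /nb_edges big_mkcond.
apply: leq_sum => e _; case: ifP => //; rewrite inE => /andP[_ /cards2P[u [v [uv ->]]]].
exact: complH.
Qed.

Lemma mgraph_eqP (T : finType) (G G' : mgraph T) :
  (forall u v, mult G [set u; v] = mult G' [set u; v]) -> G = G'.
Proof.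
move=> GG'; apply: val_inj; apply/ffunP => e.
have [/cards2P[u [v [_ ->]]] | e2] := boolP (#|e| == 2); first exact: GG'.
by rewrite !mult_eq0.
Qed.

Theorem theorem4p1 (r : nat) (V : finType) (H : mgraph V) (h k : nat)
    (r_ge5 : 5 <= r) (card_V : #|V| = r) (H_critical : color_critical r H)
    (h_def : nb_edges H = h)
    (k_large : (Num.max
       ((r%:R - 1) / (r%:R - 2%:R) * (h%:R - 1))
       (2%:R * ((r%:R - 1) / r%:R)
          * (h%:R - r%:R * (r%:R - 2%:R) / 4%:R + 1))
       < k%:R :> rat)%R) :
  exists n0 : nat, forall n : nat, n0 <= n ->
    [/\ ex k n H = k * turan_number r.-1 n,
        forall G : mgraph 'I_n,
          extremal k H G <-> mgraph_iso (color_sum (kturan k r.-1 n)) G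
      & forall c : kgraph k 'I_n,
          ~~ has_multicolored H c -> nb_edges (color_sum c) = ex k n H ->
          exists s : 'I_n -> 'I_n,
            forall i : 'I_k, sgraph_iso_by s (turan r.-1 n) (c i)].
Proof.
case: r r_ge5 card_V H_critical k_large => // q q4 cardV critH k_large /=.
have complH : complete H by apply: critical_complete; rewrite cardV.
have [x [y [xy mxy]]] := critical_simple_edge critH.
have [k1 k2] := k_large_natural q4 k_large.
(* The truncated subtraction is exact by [complete_nb_edges]. *)
pose s := nb_edges H - 'C(q.+1, 2).
have bin2E : 2 * 'C(q.+1, 2) = q.+1 * q by rewrite -mul_bin_diag bin1.
have hE : 2 * nb_edges H = 2 * s + q.+1 * q.
  have := complete_nb_edges complH; rewrite cardV /s -bin2E; clear; lia.
have cond1 : q * (2 * s + q.+1 * q) < 2 * (q.-1 * k) + 2 * q.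
  by rewrite -hE h_def; move: k1; clear; lia.
have cond2 : q * (4 * s + q.+1 * q.+1 + 4) < 2 * (q.+1 * k).
  have {}k2 : q * (2 * (2 * nb_edges H) + 4) < 2 * (q.+1 * k) + q * (q.+1 * q.-1).
    by rewrite h_def; move: k2; clear; lia.
  by rewrite hE in k2; move: k2 q4; move: (s) => t; clear; case: q => // p /=; lia.
have q_gt0 : 0 < q by lia.
exists (10 * (k ^ 3 * q ^ 3)).+1 => n n_large.
have kturan_free : ~~ has_multicolored H (kturan k q n).
  by apply: turan_free; rewrite ?cardV.
have ex_extremal (c : kgraph k 'I_n) : ~~ has_multicolored H c ->
    nb_edges (color_sum c) = ex k n H -> extremal_coloring H c.
  move=> Hc cE; split=> // c' Hc'; rewrite cE /ex.
  exact: (@leq_bigmax_cond _ (fun c : kgraph k 'I_n => ~~ has_multicolored H c)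
    (fun c => nb_edges (color_sum c)) c' Hc').
have turan_perm (c : kgraph k 'I_n) : extremal_coloring H c ->
    exists p : {perm 'I_n}, forall u v,
      mult (color_sum c) [set p u; p v] = k * (u != v %[mod q]).
  exact: extremal_is_turan q4 cardV complH xy mxy hE cond1 cond2 n c n_large.
have mult_kturan u v : mult (color_sum (kturan k q n)) [set u; v] = k * (u != v %[mod q]).
  rewrite ffunE (eq_bigr (fun=> u != v %[mod q] : nat)).
    by rewrite sum_nat_const card_ord.
  by move=> i _; rewrite ffunE mem_turan.
have iso_nb (G G' : mgraph 'I_n) : mgraph_iso G G' -> nb_edges G' = nb_edges G.
  case=> p p_bij GG'; rewrite /nb_edges [LHS](reindex (fun e : {set 'I_n} => p @: e)) /=.
    by apply: eq_bigr.
  apply: onW_bij; case: p_bij => p' pK p'K; exists (fun e : {set 'I_n} => p' @: e) => e.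
    by rewrite -imset_comp -[RHS]imset_id; apply: eq_imset => u; rewrite /= pK.
  by rewrite -imset_comp -[RHS]imset_id; apply: eq_imset => u; rewrite /= p'K.
have perm_iso (c : kgraph k 'I_n) : extremal_coloring H c ->
    mgraph_iso (color_sum (kturan k q n)) (color_sum c).
  move=> /turan_perm[p pE]; exists p; first by exists (p^-1)%g; [apply: permK|apply: permKV].
  move=> e; have pe2 : #|p @: e| = #|e| by rewrite card_imset //; apply: perm_inj.
  have [/cards2P[u [v [uv ->]]] | e2] := boolP (#|e| == 2); last by rewrite !mult_eq0 ?pe2.
  by rewrite mult_kturan imsetU1 imset_set1.
have exE : ex k n H = k * turan_number q n.
  have [|c Hc cE] := @eq_bigmax_cond _ (fun c : kgraph k 'I_n => ~~ has_multicolored H c)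
    (fun c => nb_edges (color_sum c)).
    by apply/card_gt0P; exists (kturan k q n).
  rewrite /ex cE -nb_edges_kturan; apply/iso_nb/perm_iso/ex_extremal => //.
split=> // [G | c Hc cE]; last first.
  have [p pE] := turan_perm c (ex_extremal c Hc cE).
  by exists p; apply: extremal_colors pE.
split=> [[[c <- Hc] cE] | isoG]; first by apply/perm_iso/ex_extremal.
split; last by rewrite exE (iso_nb _ _ isoG) nb_edges_kturan.
(* Conversely, an isomorphic copy is realized by pulling the Turan coloring back along the inverse
   bijection. *)
case: isoG => p [p' pK p'K] pE; exists (pull p' (kturan k q n)).
  by apply: mgraph_eqP => u v; rewrite mult_pull -pE imsetU1 imset_set1 !p'K.
by apply: contra kturan_free; apply: pull_multicolored.
Qed.
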